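(* The problem VB-SM Probabilistic Lobbying (defined in the context), parameterized by the budget $B$, is fixed-parameter tractable.
   Context: Probabilistic lobbying setting. There are $m$ voters $v_1,\dots,v_m$ and $n$ issues $r_1,\dots,r_n$. A probability matrix $P=(p_{i,j})\in(\mathbb{Q}\cap[0,1])^{m\times n}$ gives the probability that $v_i$ votes ''yes'' on $r_j$. A discretization level $k\in\mathbb{N}$ is chosen so that $k+1$ is a common multiple of the denominators of all $p_{i,j}$; admissible probability values are $0,\frac1{k+1},\dots,1$. For each $(i,j)$ a price function $c_{i,j}:\{0,\frac1{k+1},\dots,1\}\to\mathbb{N}$ with $c_{i,j}(p_{i,j})=0$, monotone in the sense that $p_{i,j}\le a\le b$ or $p_{i,j}\ge a\ge b$ implies $c_{i,j}(a)\le c_{i,j}(b)$, gives the price of changing $v_i$'s probability on $r_j$ to $a$; these form a cost matrix $C_P$ with $mn$ rows and $k+2$ columns. The Lobby has a target vector $\vec Z\in\{0,1\}^n$ and integer budget $B$; a threshold $t\in\mathbb{Q}\cap[0,1]$ is given. Voter $v_i$ favors the agenda on $r_j$ if his probability of voting $Z_j$ ($p_{i,j}$ if $Z_j=1$, $1-p_{i,j}$ if $Z_j=0$) exceeds $t$. Strict majority (SM): $r_j$ is won iff strictly more than $m/2$ voters favor the agenda on it. Voter bribery (VB): The Lobby chooses an amount $d_i\ge0$ per voter, $\sum_i d_i\le B$; $d_i$ is split equally among the $n$ issues, and for each $j$ the probability of $v_i$ on $r_j$ moves toward $Z_j$ to the farthest admissible value $a$ with $c_{i,j}(a)\le d_i/n$.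 VB-SM Probabilistic Lobbying: given $P,C_P,\vec Z,B$ (and $t$), decide whether some voter bribery within budget $B$ makes every issue won under SM. A parameterized problem is fixed-parameter tractable if instances $(I,\kappa)$ can be decided in time $f(\kappa)|I|^{c}$ for a computable $f$ and a constant $c$. *)

(* Defs.v *)
From mathcomp Require Import all_boot all_order all_algebra.

Set Implicit Arguments.
Unset Strict Implicit.
Unset Printing Implicit Defensive.

Import Order.TTheory GRing.Theory Num.Theory.

(** * Deterministic multi-tape Turing machines *)

(* A two-way infinite tape: the cells left of the head (nearest first), the
   scanned cell, and the cells right of the head.  [None] is the blank, and
   all cells beyond the two lists are blank. *)
Record tape (G : Type) := Tape {
  tape_left : seq (option G);
  tape_head : option G;
  tape_right : seq (option G) }.

Inductive direction := MoveLeft | Stay | MoveRight.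

Definition tape_of_word (G : Type) (w : seq G) : tape G :=
  let s := map Some w in Tape [::] (head None s) (behead s).

Definition tape_write (G : Type) (x : option G) (T : tape G) : tape G :=
  Tape (tape_left T) x (tape_right T).

Definition tape_move (G : Type) (d : direction) (T : tape G) : tape G :=
  let: Tape l x r := T in
  match d with
  | MoveLeft => Tape (behead l) (head None l) (x :: r)
  | Stay => T
  | MoveRight => Tape (x :: l) (head None r) (behead r)
  end.

(* The tape symbols are the input symbols [S], finitely many auxiliary symbols
   and the blank.  There are [(extra_tapes M).+1] tapes; tape [ord0] carries
   the input and, for machines that compute functions, the output. *)
Record turing_machine (S : finType) := TuringMachine {
  extra_tapes : nat;
  aux_symbol : finType;
  state : finType;
  start : state;
  halting : pred state;
  accepting : pred state;
  transition :
    state -> {ffun 'I_extra_tapes.+1 -> option (S + aux_symbol)} ->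
    state * ('I_extra_tapes.+1 -> option (S + aux_symbol) * direction) }.

Section Run.

Variables (S : finType) (M : turing_machine S).

Notation symbol := (S + aux_symbol M)%type.

Record config := Config {
  cfg_state : state M;
  cfg_tapes : 'I_(extra_tapes M).+1 -> tape symbol }.

Definition initial (w : seq S) : config :=
  Config (start M)
    (fun i => tape_of_word (if i == ord0 then map inl w else [::])).

Definition step (c : config) : config :=
  if halting (cfg_state c) then c else
  let: (q, act) :=
    transition (cfg_state c) [ffun i => tape_head (cfg_tapes c i)] in
  Config q
    (fun i => tape_move (act i).2 (tape_write (act i).1 (cfg_tapes c i))).

Definition run (time : nat) (w : seq S) : config := iter time step (initial w).

Definition halted (c : config) : bool := halting (cfg_state c).

Definition accepted (c : config) : bool := accepting (cfg_state c).

Fixpoint input_prefix (s : seq (option symbol)) : seq S :=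
  if s is Some (inl x) :: s' then x :: input_prefix s' else [::].

(* The maximal word over [S] that starts at the head of tape [ord0]. *)
Definition output (c : config) : seq S :=
  let T := cfg_tapes c ord0 in input_prefix (tape_head T :: tape_right T).

End Run.

(* Arguments and values are written in unary. *)
Definition computable (f : nat -> nat) : Prop :=
  exists M : turing_machine unit, forall x : nat, exists time : nat,
    halted (run M time (nseq x tt)) /\
    output (run M time (nseq x tt)) = nseq (f x) tt.

(** * Parameterized problems *)

Record parameterized_problem := ParameterizedProblem {
  problem_instance : Type;
  alphabet : finType;
  encode : problem_instance -> seq alphabet;
  parameter : problem_instance -> nat;
  yes_instance : problem_instance -> Prop }.

Definition fixed_parameter_tractable (Q : parameterized_problem) : Prop :=
  exists (M : turing_machine (alphabet Q)) (f : nat -> nat) (c : nat),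
    computable f /\
    forall I : problem_instance Q, exists time : nat,
      [/\ (time <= f (parameter I) * size (encode I) ^ c)%N,
          halted (run M time (encode I)) &
          accepted (run M time (encode I)) <-> yes_instance I].

(** * Binary encoding of lists of numbers *)

(* Least significant bit first. *)
Fixpoint bits_of_pos (p : BinNums.positive) : seq bool :=
  match p with
  | BinNums.xH => [:: true]
  | BinNums.xO p' => false :: bits_of_pos p'
  | BinNums.xI p' => true :: bits_of_pos p'
  end.

Definition bits_of_nat (x : nat) : seq bool :=
  if bin_of_nat x is BinNums.Npos p then bits_of_pos p else [::].

(* [Some b] is the bit [b]; [None] is the end marker of a number. *)
Definition encode_nat (x : nat) : seq (option bool) :=
  rcons (map Some (bits_of_nat x)) None.

Definition encode_nats (s : seq nat) : seq (option bool) :=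
  flatten (map encode_nat s).

(** * Probabilistic lobbying *)

Local Open Scope ring_scope.

Definition admissible (k : nat) (a : 'I_k.+2) : rat := a%:R / k.+1%:R.

(* [price i j a] is the price c_{i,j}(a/(k+1)), that is, the entry of the cost
   matrix in column [a] of the row indexed by [(i, j)]. *)
Record lobbying_instance := LobbyingInstance {
  voters : nat;
  issues : nat;
  level : nat;
  prob : 'M[rat]_(voters, issues);
  price : 'I_voters -> 'I_issues -> 'I_level.+2 -> nat;
  target : 'I_issues -> bool;
  budget : nat;
  threshold : rat;
  prob_unit : forall i j, 0 <= prob i j <= 1;
  prob_level : forall i j, (denq (prob i j) %| level.+1%:Z)%Z;
  price_prob : forall i j a, admissible a = prob i j -> price i j a = 0%N;
  price_monotone : forall i j (a b : 'I_level.+2),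
    prob i j <= admissible a <= admissible b \/
    admissible b <= admissible a <= prob i j ->
    (price i j a <= price i j b)%N;
  threshold_unit : 0 <= threshold <= 1 }.

Section VoterBribery.

Variable L : lobbying_instance.

Definition affordable (d : 'I_(voters L) -> rat)
    (i : 'I_(voters L)) (j : 'I_(issues L)) (a : 'I_(level L).+2) : bool :=
  (price i j a)%:R <= d i / (issues L)%:R.

(* The index [prob L i j] of the big operators is itself an affordable
   admissible value, so it only serves as a default formally. *)
Definition bribed_prob (d : 'I_(voters L) -> rat)
    (i : 'I_(voters L)) (j : 'I_(issues L)) : rat :=
  if target j then
    \big[Num.max/prob L i j]_(a : 'I_(level L).+2 |
      (prob L i j <= admissible a) && affordable d i j a) admissible a
  else
    \big[Num.min/prob L i j]_(a : 'I_(level L).+2 |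
      (admissible a <= prob L i j) && affordable d i j a) admissible a.

Definition favors (q : 'I_(voters L) -> 'I_(issues L) -> rat)
    (i : 'I_(voters L)) (j : 'I_(issues L)) : bool :=
  threshold L < (if target j then q i j else 1 - q i j).

Definition won_strict_majority (q : 'I_(voters L) -> 'I_(issues L) -> rat)
    (j : 'I_(issues L)) : bool :=
  (voters L)%:R / 2%:R < #|[set i | favors q i j]|%:R :> rat.

Definition voter_bribery (d : 'I_(voters L) -> rat) : Prop :=
  (forall i, 0 <= d i) /\ \sum_i d i <= (budget L)%:R.

Definition vb_sm_winnable : Prop :=
  exists d : 'I_(voters L) -> rat,
    voter_bribery d /\ forall j, won_strict_majority (bribed_prob d) j.

(* A nonnegative rational is written as its numerator and denominator. *)
Definition rat_numbers (x : rat) : seq nat := [:: `|numq x|%N; `|denq x|%N].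

Definition voter_issue_numbers (i : 'I_(voters L)) (j : 'I_(issues L)) :
    seq nat :=
  rat_numbers (prob L i j) ++ [seq price i j a | a <- enum 'I_(level L).+2].

Definition lobbying_numbers : seq nat :=
  [:: voters L; issues L; level L; budget L] ++ rat_numbers (threshold L) ++
  [seq nat_of_bool (target j) | j <- enum 'I_(issues L)] ++
  flatten [seq voter_issue_numbers i j
          | i <- enum 'I_(voters L), j <- enum 'I_(issues L)].

Definition encode_lobbying : seq (option bool) := encode_nats lobbying_numbers.

End VoterBribery.

Definition vb_sm_lobbying : parameterized_problem :=
  ParameterizedProblem encode_lobbying budget vb_sm_winnable.

(* Main.v *)
(* Prices are natural numbers, so only e_i = floor(d_i / n) matters for voter i,
   and the e_i are bounded by b = floor(B / n) in total.  Voter i favors the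
   agenda on issue j iff e_i is at least w_ij, the least price of a favorable
   admissible value; capping w_ij at b + 1 changes nothing.  Voters with the same
   capped row (w_i1, ..., w_in) are interchangeable, and at most b of them have
   e_i > 0, so a bribery is described up to this symmetry by a word of length at
   most B (B + 3) over three symbols: the list, in voter order, of the pairs of
   e_i > 0 and the row of voter i.  Paying each voter greedily from the first
   remaining pair if the rows agree realizes such a word.  The machine computes
   the rows in polynomial time (up to factors depending on B) and tries all
   3 ^ (B (B + 3)) words.  It is obtained from a structured program over stacks,
   each tape of the machine holding one stack. *)
From mathcomp Require Import all_boot all_order all_algebra.
From mathcomp Require Import zify ring lra.
From Stdlib Require Import FunctionalExtensionality.
Require Import Defs.

Set Implicit Arguments.
Unset Strict Implicit.
Unset Printing Implicit Defensive.

(** * Stack programs and their compilation to Turing machines *)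

Section StackPrograms.

Variables (k : nat) (A : finType).

Local Notation reg := 'I_k.+1.
Local Notation store := (reg -> seq A).
Local Notation heads := (reg -> option A).

(** The number of voters is not bounded in terms of B, so a guess must not name voters: it names
    rows, and a voter with the right row claims the slot. The number n of issues is not bounded
    either, but b = floor(B / n) satisfies b n <= B, so either b = 0 and the list of pairs is empty,
    or n <= B. A pair takes e separators and at most n (b + 2) digits; all pairs together take at
    most b (1 + n (b + 2)) <= B + B (B + 2) symbols, which is the length B (B + 3). Every word of
    that length is harmless: the payments read off it total at most its number of separators, so no
    test of well-formedness is made. Greedy claiming may pay another voter than the intended one,
    but one with the same row, and majorities see only the multiset of pairs of row and payment. The
    numbers B, n and k are affordable in unary, whereas prices and the threshold are not: prices are
    capped while they are read, and the index of the threshold is found by repeated binary addition.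
    Finally, f itself must be computed by a machine, which suggests a bound obtained by repeated
    doubling. *)

Inductive cmd :=
| Nop
| Push of reg & (heads -> A)
| Pop of reg
| Seq of cmd & cmd
| If of (heads -> bool) & cmd & cmd
| While of (heads -> bool) & cmd.

Definition tops (s : store) : heads := fun i => ohead (s i).

Definition upd (s : store) (i : reg) (v : seq A) : store :=
  fun r => if r == i then v else s r.

Inductive exec : cmd -> store -> store -> nat -> Prop :=
| ExecNop s : exec Nop s s 1
| ExecPush i f s : exec (Push i f) s (upd s i (f (tops s) :: s i)) 2
| ExecPop i s : exec (Pop i) s (upd s i (behead (s i))) 1
| ExecSeq c1 c2 s s1 s2 t1 t2 :
    exec c1 s s1 t1 -> exec c2 s1 s2 t2 -> exec (Seq c1 c2) s s2 (t1 + t2)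
| ExecIfT (p : heads -> bool) c1 c2 s s' t :
    p (tops s) -> exec c1 s s' t -> exec (If p c1 c2) s s' t.+1
| ExecIfF (p : heads -> bool) c1 c2 s s' t :
    ~~ p (tops s) -> exec c2 s s' t -> exec (If p c1 c2) s s' t.+1
| ExecWhileT (p : heads -> bool) c s s1 s2 t1 t2 :
    p (tops s) -> exec c s s1 t1 -> exec (While p c) s1 s2 t2 ->
    exec (While p c) s s2 (t1 + t2).+1
| ExecWhileF (p : heads -> bool) c s : ~~ p (tops s) -> exec (While p c) s s 1.

Definition runs (c : cmd) (s s' : store) (T : nat) :=
  exists2 t, t <= T & exec c s s' t.

(* The control points of a program.  A pushed symbol is chosen before the head
   moves onto the cell to be written, so it is kept in the control point. *)
Fixpoint point (c : cmd) : finType :=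
  match c with
  | Nop => unit : finType
  | Push _ _ => option A : finType
  | Pop _ => unit : finType
  | Seq c1 c2 => (point c1 + point c2)%type : finType
  | If _ c1 c2 => option (point c1 + point c2) : finType
  | While _ c1 => option (point c1) : finType
  end.

Fixpoint entry (c : cmd) : point c :=
  match c with
  | Nop => tt
  | Push _ _ => None
  | Pop _ => tt
  | Seq c1 _ => inl (entry c1)
  | If _ _ _ => None
  | While _ _ => None
  end.

Local Notation action := (reg -> option A * direction).

Definition still (h : heads) : action := fun i => (h i, Stay).

Definition at_reg (h : heads) (i : reg) (x : option A) (d : direction) : action :=
  fun r => if r == i then (x, d) else (h r, Stay).

(* The control point [None] leaves the program. *)
Fixpoint next (c : cmd) : point c -> heads -> option (point c) * action :=
  match c with
  | Nop => fun _ h => (None, still h)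
  | Push i f => fun q h =>
      if q is Some x then (None, at_reg h i (Some x) Stay)
      else (Some (Some (f h)), at_reg h i (h i) MoveLeft)
  | Pop i => fun _ h => (None, at_reg h i None MoveRight)
  | Seq c1 c2 => fun q h =>
      match q with
      | inl q1 => let: (q', a) := next q1 h in
          (Some (if q' is Some q1' then inl q1' else inr (entry c2)), a)
      | inr q2 => let: (q', a) := next q2 h in (omap inr q', a)
      end
  | If p c1 c2 => fun q h =>
      match q with
      | None => (Some (Some (if p h then inl (entry c1) else inr (entry c2))),
                 still h)
      | Some (inl q1) => let: (q', a) := next q1 h in
          (omap (Some \o inl) q', a)
      | Some (inr q2) => let: (q', a) := next q2 h in
          (omap (Some \o inr) q', a)
      end
  | While p c1 => fun q h =>
      match q with
      | None => (if p h then Some (Some (entry c1)) else None, still h)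
      | Some q1 => let: (q', a) := next q1 h in (Some q', a)
      end
  end.

(** * Tapes as stacks, and the simulation of programs *)

Local Notation symbol := (A + void)%type.

Definition stack_symbol (x : option symbol) : option A :=
  if x is Some (inl a) then Some a else None.

Definition tape_symbol : option A -> option symbol := omap inl.

Local Notation tapes := (reg -> tape symbol).

Definition scan (T : tapes) : heads := fun i => stack_symbol (tape_head (T i)).

Definition perform (a : action) (T : tapes) : tapes :=
  fun i => tape_move (a i).2 (tape_write (tape_symbol (a i).1) (T i)).

Inductive leaves (c : cmd) : point c -> tapes -> tapes -> nat -> Prop :=
| Leaves1 q T :
    (next q (scan T)).1 = None ->
    leaves q T (perform (next q (scan T)).2 T) 1
| LeavesS q q' T T' t :
    (next q (scan T)).1 = Some q' ->
    leaves q' (perform (next q (scan T)).2 T) T' t -> leaves q T T' t.+1.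

(** The top of the stack is under the head and the stack extends to the right. The cells to the left
    are unconstrained because a push overwrites the cell it moves onto; [n] absorbs explicit blanks
    beyond the stack. *)
Definition represents (s : seq A) (T : tape symbol) : Prop :=
  exists n, tape_head T :: tape_right T
            = map (fun x => Some (inl x)) s ++ nseq n None.

Definition store_on (s : store) (T : tapes) : Prop :=
  forall i, represents (s i) (T i).

Lemma represents_head s T : represents s T -> stack_symbol (tape_head T) = ohead s.
Proof. by case: s => [|x s] [[|n]] //= [-> _]. Qed.

Lemma scan_store s T : store_on s T -> scan T = tops s.
Proof.
move=> sT; apply: functional_extensionality => i.
exact: represents_head (sT i).
Qed.

Lemma tape_symbolK x : tape_symbol (stack_symbol x) = x.
Proof. by case: x => [[|[]]|]. Qed.

Lemma perform_still T : perform (still (scan T)) T = T.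
Proof.
apply: functional_extensionality => i; rewrite /perform /= /scan tape_symbolK.
by case: (T i).
Qed.

Lemma perform_at T i x d :
  perform (at_reg (scan T) i x d) T
  = fun r => if r == i then tape_move d (tape_write (tape_symbol x) (T r)) else T r.
Proof.
apply: functional_extensionality => r; rewrite /perform /at_reg.
by case: eqP => //= _; rewrite /scan tape_symbolK; case: (T r).
Qed.

Lemma represents_pop s T x :
  represents s T -> represents (behead s) (tape_move MoveRight (tape_write x T)).
Proof.
case: T => l y r [n /=]; case: s => [|z s] /=.
  case: n => [|n] //= [_ ->]; case: n => [|n]; first by exists 1.
  by exists n.+1.
by case=> _ ->; case: s => [|z' s] /=; [case: n => [|n]; [exists 1 | exists n.+1]|
   exists n].
Qed.

Lemma leaves_seq c1 c2 q T T1 T2 t1 t2 :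
  @leaves c1 q T T1 t1 -> leaves (entry c2) T1 T2 t2 ->
  @leaves (Seq c1 c2) (inl q) T T2 (t1 + t2).
Proof.
move=> H1; elim: H1 => {q T T1 t1} [q T|q q' T T' t] E => [|_ IH] H2.
  apply: (@LeavesS (Seq c1 c2) _ (inr (entry c2))); rewrite /=.
    by case: next E => [? ?] /= ->.
  case: next E H2 => [? a] /= _; move: (perform a T) => {q a} U H2.
  elim: H2 => {U T2 t2} [r U|r r' U U' u] F => [|_ IH].
    have := @Leaves1 (Seq c1 c2) (inr r) U; rewrite /=.
    by case: next F => [? ?] /= -> ; apply.
    apply: (@LeavesS (Seq c1 c2) _ (inr r')); rewrite /=.
      by case: next F => [? ?] /= ->.
    by case: next F IH => [? ?] /= _; apply.
rewrite addSn; apply: (@LeavesS (Seq c1 c2) _ (inl q')); rewrite /=.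
  by case: next E => [? ?] /= ->.
by case: next E IH => [? ?] /= _; apply.
Qed.

Lemma leaves_ifl p c1 c2 q T T' t :
  @leaves c1 q T T' t -> @leaves (If p c1 c2) (Some (inl q)) T T' t.
Proof.
elim=> {q T T' t} [q T|q q' T T' t] E => [|_ IH].
  have := @Leaves1 (If p c1 c2) (Some (inl q)) T; rewrite /=.
  by case: next E => [? ?] /= ->; apply.
apply: (@LeavesS (If p c1 c2) _ (Some (inl q'))); rewrite /=.
  by case: next E => [? ?] /= ->.
by case: next E IH => [? ?] /= _; apply.
Qed.

Lemma leaves_ifr p c1 c2 q T T' t :
  @leaves c2 q T T' t -> @leaves (If p c1 c2) (Some (inr q)) T T' t.
Proof.
elim=> {q T T' t} [q T|q q' T T' t] E => [|_ IH].
  have := @Leaves1 (If p c1 c2) (Some (inr q)) T; rewrite /=.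
  by case: next E => [? ?] /= ->; apply.
apply: (@LeavesS (If p c1 c2) _ (Some (inr q'))); rewrite /=.
  by case: next E => [? ?] /= ->.
by case: next E IH => [? ?] /= _; apply.
Qed.

Lemma leaves_while p c q T T1 T2 t1 t2 :
  @leaves c q T T1 t1 -> @leaves (While p c) None T1 T2 t2 ->
  @leaves (While p c) (Some q) T T2 (t1 + t2).
Proof.
move=> H1 H2; elim: H1 H2 => {q T T1 t1} [q T|q q' T T' t] E => [|_ IH] H2.
  apply: (@LeavesS (While p c) _ None); rewrite /=.
    by case: next E => [? ?] /= ->.
  by case: next E H2 => [? ?] /= _; apply.
rewrite addSn; apply: (@LeavesS (While p c) _ (Some q')); rewrite /=.
  by case: next E => [? ?] /= ->.
by case: next E IH => [? ?] /= _; apply.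
Qed.

(** The costs in [exec] are the exact numbers of machine steps (two for a push: move, then write;
    one for each test), so times carry over without overhead. *)
Lemma exec_leaves c s s' t : exec c s s' t -> forall T, store_on s T ->
  exists2 T', leaves (entry c) T T' t & store_on s' T'.
Proof.
elim=> {c s s' t}.
- move=> s T sT; exists T => //.
  by have := @Leaves1 Nop tt T erefl; rewrite /= perform_still.
- move=> i f s T sT.
  eexists; first apply: (@LeavesS (Push i f) _ (Some (f (tops s)))).
  + by rewrite /= (scan_store sT).
  + exact: Leaves1.
  move=> r; rewrite !perform_at /upd; case: eqP => [->|_]; last exact: sT.
  have [n] := sT i; rewrite /scan tape_symbolK.
  by case: (T i) => l x w /= E; exists n; rewrite E.
- move=> i s T sT; eexists; first exact: Leaves1.
  move=> r; rewrite perform_at /upd; case: eqP => [->|_]; last exact: sT.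
  exact: represents_pop.
- move=> c1 c2 s s1 s2 t1 t2 _ IH1 _ IH2 T /IH1 [T1 H1 /IH2 [T2 H2 sT2]].
  by exists T2 => //; apply: leaves_seq H2.
- move=> p c1 c2 s s' t ps _ IH T sT; have [T' H sT'] := IH T sT; exists T' => //.
  apply: (@LeavesS (If p c1 c2) _ (Some (inl (entry c1)))) => /=.
    by rewrite (scan_store sT) ps.
  by rewrite perform_still; apply: leaves_ifl.
- move=> p c1 c2 s s' t /negbTE ps _ IH T sT; have [T' H sT'] := IH T sT; exists T' => //.
  apply: (@LeavesS (If p c1 c2) _ (Some (inr (entry c2)))) => /=.
    by rewrite (scan_store sT) ps.
  by rewrite perform_still; apply: leaves_ifr.
- move=> p c s s1 s2 t1 t2 ps _ IH1 _ IH2 T sT.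
  have [T1 H1 /IH2 [T2 H2 sT2]] := IH1 T sT; exists T2 => //.
  apply: (@LeavesS (While p c) _ (Some (entry c))) => /=.
    by rewrite (scan_store sT) ps.
  by rewrite perform_still; apply: leaves_while H2.
- move=> p c s /negbTE ps T sT; exists T => //.
  have := @Leaves1 (While p c) None T.
  by rewrite /= (scan_store sT) ps => /(_ erefl); rewrite -(scan_store sT) perform_still.
Qed.

Variables (c : cmd) (p : heads -> bool).

(* After leaving [c], the machine evaluates [p] in the state [inr None]. *)
Definition machine_next (q : point c + option bool) (h : heads) :
    (point c + option bool) * action :=
  match q with
  | inl q1 => let: (q', a) := next q1 h in
      (if q' is Some q1' then inl q1' else inr None, a)
  | inr _ => (inr (Some (p h)), still h)
  end.

Definition machine : turing_machine A :=
  @TuringMachine A k void (point c + option bool)%type (inl (entry c))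
    (fun q => if q is inr (Some _) then true else false)
    (fun q => if q is inr (Some b) then b else false)
    (fun q h =>
       let: (q', a) := machine_next q (fun i => stack_symbol (h i)) in
       (q', fun i => (tape_symbol (a i).1, (a i).2))).

Definition input_store (w : seq A) : store := fun i => if i == ord0 then w else [::].

Lemma machine_step q T : ~~ halting (t := machine) q ->
  step (Config (M := machine) q T)
  = Config (M := machine) (machine_next q (scan T)).1
      (perform (machine_next q (scan T)).2 T).
Proof.
move=> /negbTE nh; rewrite /step nh /=.
have -> : (fun i => stack_symbol ([ffun i0 => tape_head (T i0)] i)) = scan T.
  by apply: functional_extensionality => i; rewrite ffunE.
by case: machine_next.
Qed.

Lemma machine_leaves q T T' t : leaves q T T' t ->
  iter t (@step _ machine) (Config (M := machine) (inl q) T)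
  = Config (M := machine) (inr None) T'.
Proof.
elim=> {q T T' t} [q T|q q' T T' t] E => [|_ IH].
  by rewrite /= machine_step //=; case: next E => ? ? /= ->.
rewrite iterSr machine_step //= -IH.
by case: next E => ? ? /= ->.
Qed.

(** The additional step evaluates [p] after [c] has been left. *)
Lemma machine_runs w s T : runs c (input_store w) s T ->
  exists time, [/\ time <= T.+1, halted (run machine time w),
    accepted (run machine time w) = p (tops s) &
    output (run machine time w) = s ord0].
Proof.
case=> t tT /exec_leaves /(_ (cfg_tapes (initial machine w))) [i|T' H sT'].
  by rewrite /input_store /=; case: eqP => _; [exists (w == [::]) | exists 1];
     case: (w) => //= a v; rewrite cats0 -map_comp.
exists t.+1; rewrite /run iterS (machine_leaves H) machine_step //=.
rewrite /halted /accepted /output /= tape_symbolK (scan_store sT'); split => //.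
rewrite -[LHS]/(input_prefix (M := machine) (tape_head (T' ord0) :: tape_right (T' ord0))).
have [n ->] := sT' ord0.
by elim: (s ord0) => [|x v IH] /=; [case: n | rewrite IH].
Qed.

End StackPrograms.

(** * Running times of stack programs *)

Arguments Nop {k A}.
Arguments Pop {k A}.

Ltac store_eq :=
  apply: functional_extensionality => ?; rewrite /upd;
  repeat match goal with
  | H : is_true (_ != _) |- _ => move: H => /eqP H
  end;
  repeat (case: eqP => [?|?]; [subst|]; rewrite ?eqxx //=).

Section Programs.

Variables (k : nat) (A : finType).

Local Notation reg := 'I_k.+1.
Local Notation store := (reg -> seq A).
Implicit Types (s : store) (c : cmd k A) (p : (reg -> option A) -> bool).

Lemma runs_nop s : runs Nop s s 1.
Proof. by exists 1 => //; apply: ExecNop. Qed.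

Lemma runs_nop_le s s' T : s = s' -> 0 < T -> runs Nop s s' T.
Proof. by move=> <- T0; exists 1 => //; apply: ExecNop. Qed.

Lemma runs_push i f s : runs (Push i f) s (upd s i (f (tops s) :: s i)) 2.
Proof. by exists 2 => //; apply: ExecPush. Qed.

Lemma runs_pop i s : runs (Pop i) s (upd s i (behead (s i))) 1.
Proof. by exists 1 => //; apply: ExecPop. Qed.

Lemma runs_seq c1 c2 s s1 s2 T1 T2 :
  runs c1 s s1 T1 -> runs c2 s1 s2 T2 -> runs (Seq c1 c2) s s2 (T1 + T2).
Proof.
move=> [t1 le1 r1] [t2 le2 r2]; exists (t1 + t2); first exact: leq_add.
exact: ExecSeq r1 r2.
Qed.

Lemma runs_ifT p c1 c2 s s' T :
  p (tops s) -> runs c1 s s' T -> runs (If p c1 c2) s s' T.+1.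
Proof. by move=> ps [t le r]; exists t.+1 => //; apply: ExecIfT. Qed.

Lemma runs_ifF p c1 c2 s s' T :
  ~~ p (tops s) -> runs c2 s s' T -> runs (If p c1 c2) s s' T.+1.
Proof. by move=> ps [t le r]; exists t.+1 => //; apply: ExecIfF. Qed.

Lemma runs_whileT p c s s1 s2 T1 T2 :
  p (tops s) -> runs c s s1 T1 -> runs (While p c) s1 s2 T2 ->
  runs (While p c) s s2 (T1 + T2).+1.
Proof.
move=> ps [t1 le1 r1] [t2 le2 r2]; exists (t1 + t2).+1.
  by rewrite ltnS leq_add.
exact: ExecWhileT r2.
Qed.

Lemma runs_whileF p c s : ~~ p (tops s) -> runs (While p c) s s 1.
Proof. by move=> ps; exists 1 => //; apply: ExecWhileF. Qed.

Lemma runs_le c s s' T T' : runs c s s' T -> T <= T' -> runs c s s' T'.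
Proof. by move=> [t le r] le'; exists t => //; apply: leq_trans le'. Qed.

Lemma runs_eq c s s1 s2 T : runs c s s1 T -> s1 = s2 -> runs c s s2 T.
Proof. by move=> ? <-. Qed.

Lemma updK s i v w : upd (upd s i v) i w = upd s i w.
Proof. by apply: functional_extensionality => r; rewrite /upd; case: eqP. Qed.

Lemma upd_id s i : upd s i (s i) = s.
Proof. by apply: functional_extensionality => r; rewrite /upd; case: eqP => // ->. Qed.

Lemma updC s i j v w : i != j -> upd (upd s i v) j w = upd (upd s j w) i v.
Proof.
move=> /negbTE ij; apply: functional_extensionality => r; rewrite /upd.
by case: (r =P j) => // ->; rewrite eq_sym ij.
Qed.

Lemma upd_same s i v : upd s i v i = v.
Proof. by rewrite /upd eqxx. Qed.

Lemma upd_other s i j v : i != j -> upd s i v j = s j.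
Proof. by rewrite /upd eq_sym => /negbTE ->. Qed.

Variable a0 : A.

Definition top_is (P : pred A) (i : reg) : (reg -> option A) -> bool :=
  fun h => if h i is Some x then P x else false.

Definition top_of (i : reg) : (reg -> option A) -> A := fun h => odflt a0 (h i).

Definition mov (i j : reg) : cmd k A := Seq (Push j (top_of i)) (Pop i).

Definition transfer (P : pred A) (i j : reg) := While (top_is P i) (mov i j).

Definition discard (P : pred A) (i : reg) : cmd k A := While (top_is P i) (Pop i).

(** A transfer reverses the word, so the return trip from the scratch register [t] restores the
    order, both in [i] and in [j]. *)
Definition copy (i j t : reg) : cmd k A :=
  Seq (transfer predT i t)
      (While (top_is predT t) (Seq (Push i (top_of t)) (mov t j))).

Definition stops (P : pred A) (r : seq A) := if r is x :: _ then ~~ P x else true.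

Lemma runs_mov i j s x r : i != j -> s i = x :: r ->
  runs (mov i j) s (upd (upd s i r) j (x :: s j)) 3.
Proof.
move=> ij si; rewrite /mov.
have H := runs_seq (runs_push j (top_of i) s) (runs_pop i _).
apply: (runs_le _ (leqnn 3)); move: (H); congr (runs _ _ _ _).
by rewrite upd_other 1?eq_sym // si [LHS]updC 1?eq_sym // /top_of /tops si.
Qed.

Lemma runs_transfer P i j s u r : i != j -> s i = u ++ r -> all P u -> stops P r ->
  runs (transfer P i j) s (upd (upd s i r) j (rev u ++ s j)) (4 * size u + 1).
Proof.
move=> ij; elim: u s => [|x u IH] s /= si => [_ sr|/andP[px pu] sr].
  rewrite (_ : upd _ _ _ = s); last by rewrite -si !upd_id.
  by apply: runs_whileF; rewrite /top_is /tops si; case: (r) sr.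
apply: (@runs_le _ _ _ (3 + (4 * size u + 1)).+1); last by lia.
apply: runs_whileT; first by rewrite /top_is /tops si.
  exact: (runs_mov ij si).
have := IH (upd (upd s i (u ++ r)) j (x :: s j)).
rewrite upd_other 1?eq_sym // upd_same => /(_ erefl pu sr).
rewrite upd_same -cat_rcons -rev_cons; congr (runs _ _ _ _).
by rewrite (updC _ _ _ ij) !updK -(updC _ _ _ ij) updK.
Qed.

Lemma runs_discard P i s u r : s i = u ++ r -> all P u -> stops P r ->
  runs (discard P i) s (upd s i r) (2 * size u + 1).
Proof.
elim: u s => [|x u IH] s /= si => [_ sr|/andP[px pu] sr].
  rewrite -si upd_id.
  by apply: runs_whileF; rewrite /top_is /tops si; case: (r) sr.
apply: (@runs_le _ _ _ (1 + (2 * size u + 1)).+1); last by lia.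
apply: runs_whileT; first by rewrite /top_is /tops si.
  exact: runs_pop.
have := IH (upd s i (behead (s i))).
by rewrite upd_same updK si => /(_ erefl pu sr).
Qed.

Lemma runs_move i j s : i != j ->
  runs (transfer predT i j) s (upd (upd s i [::]) j (rev (s i) ++ s j))
    (4 * size (s i) + 1).
Proof. by move=> ij; apply: runs_transfer => //; rewrite ?cats0 ?all_predT. Qed.

Lemma runs_copy i j t s : i != j -> i != t -> j != t -> s t = [::] ->
  runs (copy i j t) s (upd s j (s i ++ s j)) (10 * size (s i) + 2).
Proof.
move=> ij it jt st; rewrite /copy.
have H u s1 : s1 t = u ->
    runs (While (top_is predT t) (Seq (Push i (top_of t)) (mov t j)))
      s1 (upd (upd (upd s1 t [::]) i (rev u ++ s1 i)) j (rev u ++ s1 j))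
      (6 * size u + 1).
  elim: u s1 => [|x u IH] s1 s1t.
    rewrite (_ : upd _ _ _ = s1); last by store_eq.
    by apply: runs_whileF; rewrite /top_is /tops s1t.
  apply: (@runs_le _ _ _ ((2 + 3) + (6 * size u + 1)).+1); last by rewrite /=; lia.
  apply: runs_whileT; first by rewrite /top_is /tops s1t.
    apply: runs_seq; first exact: runs_push.
    apply: (@runs_mov _ _ _ x u); first by rewrite eq_sym.
    by rewrite upd_other.
  rewrite /top_of {1}/tops s1t /=.
  apply: runs_eq; first by apply: IH; rewrite upd_other ?upd_same.
  rewrite !rev_cons -!cats1 -!catA /=.
  by store_eq.
apply: (@runs_le _ _ _ (4 * size (s i) + 1 + (6 * size (rev (s i)) + 1))).
  apply: runs_seq; first exact: runs_move.
  apply: runs_eq; first by apply: H; rewrite upd_same st cats0.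
  by rewrite revK; store_eq; rewrite ?cats0.
by rewrite size_rev; lia.
Qed.

End Programs.

(** * Programs on explicit stacks *)

Arguments tops {k A} s i /.
Arguments top_is {k A} P i h /.
Arguments top_of {k A} a0 i h /.

Local Notation sym := (option bool).
Local Notation reg := 'I_20.
Local Notation "$ n" := (@Ordinal 20 n isT) (at level 0, n constr at level 0).
Local Notation one := (Some true).
Local Notation zero := (Some false).
Local Notation sep := (None : sym).
Local Notation "c1 ;; c2" := (Seq c1 c2) (at level 70, right associativity).

(** With the stacks listed explicitly, simplification computes the effect of each command, and runs
    are verified by symbolic execution. *)
Definition stacks (l : seq (seq sym)) : reg -> seq sym := fun i => nth [::] l i.
Arguments stacks l i /.

Definition nonempty (i : reg) := top_is (A := sym) predT i.
Arguments nonempty i h /.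
Definition push (i : reg) (x : sym) : cmd 19 sym := Push i (fun _ => x).
Definition move_all (i j : reg) := transfer (None : sym) predT i j.
Definition erase (i : reg) : cmd 19 sym := discard predT i.
Definition at_one (x : option sym) := if x is Some one then true else false.

Lemma upd_st l (i : reg) v : upd (stacks l) i v = stacks (set_nth [::] l i v).
Proof.
apply: functional_extensionality => r; rewrite /upd /stacks nth_set_nth /=.
by [].
Qed.

Lemma runs_push_st i f l :
  runs (Push i f) (stacks l) (stacks (set_nth [::] l i (f (tops (stacks l)) :: nth [::] l i))) 2.
Proof. by have := runs_push i f (stacks l); rewrite upd_st. Qed.

Lemma runs_pop_st i l :
  runs (Pop i) (stacks l) (stacks (set_nth [::] l i (behead (nth [::] l i)))) 1.
Proof. by have := runs_pop i (stacks l); rewrite upd_st. Qed.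

Lemma runs_transfer_st (P : pred sym) (i j : reg) l u r :
  i != j -> nth [::] l i = u ++ r -> all P u -> stops P r ->
  runs (transfer None P i j) (stacks l)
    (stacks (set_nth [::] (set_nth [::] l i r) j (rev u ++ nth [::] l j))) (4 * size u + 1).
Proof.
move=> ij li Pu Pr; have := @runs_transfer _ _ (None : sym) P i j (stacks l) u r ij li Pu Pr.
by rewrite !upd_st.
Qed.

Lemma runs_discard_st (P : pred sym) (i : reg) l u r :
  nth [::] l i = u ++ r -> all P u -> stops P r ->
  runs (discard P i) (stacks l) (stacks (set_nth [::] l i r)) (2 * size u + 1).
Proof. by move=> li Pu Pr; have := @runs_discard _ _ P i (stacks l) u r li Pu Pr; rewrite !upd_st. Qed.

Lemma runs_move_st (i j : reg) l : i != j ->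
  runs (move_all i j) (stacks l)
    (stacks (set_nth [::] (set_nth [::] l i [::]) j (rev (nth [::] l i) ++ nth [::] l j)))
    (4 * size (nth [::] l i) + 1).
Proof. by move=> ij; apply: runs_transfer_st; rewrite ?cats0 ?all_predT. Qed.

Lemma runs_clear_st (i : reg) l :
  runs (erase i) (stacks l) (stacks (set_nth [::] l i [::])) (2 * size (nth [::] l i) + 1).
Proof. by apply: runs_discard_st; rewrite ?cats0 ?all_predT. Qed.

Lemma runs_copy_st (i j t : reg) l : i != j -> i != t -> j != t -> nth [::] l t = [::] ->
  runs (copy None i j t) (stacks l) (stacks (set_nth [::] l j (nth [::] l i ++ nth [::] l j)))
    (10 * size (nth [::] l i) + 2).
Proof.
move=> ij it jt lt; have := @runs_copy _ _ (None : sym) i j t (stacks l) ij it jt lt.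
by rewrite upd_st.
Qed.

Lemma runs_mov_st (i j : reg) l x r : i != j -> nth [::] l i = x :: r ->
  runs (mov None i j) (stacks l) (stacks (set_nth [::] (set_nth [::] l i r) j (x :: nth [::] l j))) 3.
Proof.
by move=> ij li; have := @runs_mov _ _ (None : sym) i j (stacks l) x r ij li; rewrite !upd_st.
Qed.

Ltac xcmd :=
  first [ eapply runs_push_st | eapply runs_pop_st | apply: runs_nop
        | eapply runs_move_st; reflexivity | eapply runs_clear_st
        | eapply runs_copy_st; reflexivity
        | eapply runs_mov_st; reflexivity ].
Ltac xstep := eapply runs_seq; [solve [xcmd] | cbn [set_nth nth nat_of_ord ncons ssrfun.comp]; simpl].
Ltac xlast := eapply runs_eq; [solve [xcmd] | simpl].
(** The cost stays an existential variable that the symbolic run fills in; its comparison with the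
    claimed bound is the last goal. *)
Ltac xrun := eapply runs_le.
Ltac xloop := eapply runs_whileT; [by [] | | ].
Ltac xexit := by apply: runs_whileF.

(** * Unary and binary numerals *)

Local Notation ones n := (nseq n (one : sym)).
Definition bits (s : seq bool) : seq sym := map Some s.

Fixpoint lsb (s : seq bool) : nat := if s is b :: s' then b + 2 * lsb s' else 0.

Definition double_unary : cmd 19 sym :=
  While (nonempty $2) (push $3 one ;; push $3 one ;; Pop $2).

Lemma runs_double a0 a1 v x l :
  runs double_unary (stacks [:: a0, a1, ones v, ones x & l])
    (stacks [:: a0, a1, [::], ones (2 * v + x) & l]) (6 * v + 1).
Proof.
elim: v x => [|v IH] x; first by xexit.
xrun; first xloop.
- xstep. xstep. xlast. reflexivity.
- eapply runs_eq. apply: (IH x.+2). by rewrite mulnS !addnS.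
by lia.
Qed.

Lemma rev_nseq (A : Type) n (x : A) : rev (nseq n x) = nseq n x.
Proof.
elim: n => // n IH; rewrite -[in LHS]addn1 nseqD rev_cat IH /=.
by rewrite -[LHS]/([:: x] ++ nseq n x).
Qed.

Definition horner (v : nat) (ms : seq bool) : nat :=
  foldl (fun v (b : bool) => b + 2 * v) v ms.

Lemma horner_ge v ms : v <= horner v ms.
Proof.
elim: ms v => //= b ms IH v; apply: leq_trans (IH _).
by rewrite mul2n -addnn addnA leq_addl.
Qed.

Lemma horner_rev s v : horner v (rev s) = lsb s + v * 2 ^ size s.
Proof.
elim: s v => [|b s IH] v /=; first by rewrite muln1.
by rewrite rev_cons /horner foldl_rcons -/(horner v (rev s)) IH expnS; lia.
Qed.

(** Horner's rule, most significant digit first. The cost grows with the value and not only with the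
    number of digits, so this is applied only to [n], [k] and the budget, which are bounded by the
    input length or are the parameter. *)
Definition conv : cmd 19 sym :=
  While (nonempty $1)
    (double_unary ;; If (fun h => at_one (h $1)) (push $3 one) Nop ;; Pop $1 ;; move_all $3 $2).

Lemma runs_conv a0 ms v l :
  runs conv (stacks [:: a0, bits ms, ones v, [::] & l])
    (stacks [:: a0, [::], ones (horner v ms), [::] & l])
    ((14 * horner v ms + 13) * size ms + 1).
Proof.
elim: ms v => [|b ms IH] v; first by rewrite muln0; xexit.
have := horner_ge (b + 2 * v) ms; rewrite -/(horner v (b :: ms)) => vV.
xrun; first eapply runs_whileT; first by [].
- eapply runs_seq; first exact: (runs_double _ _ _ 0).
  eapply (@runs_seq _ _ _ _ _ (stacks [:: a0, bits (b :: ms), [::], ones (b + 2 * v) & l])).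
    rewrite addn0; case: b {vV} => /=.
      by eapply runs_ifT; [|xlast].
    by eapply runs_ifF; [|apply: runs_nop_le].
  xstep. xlast. rewrite rev_nseq cats0. reflexivity.
- exact: IH.
rewrite -/(horner _ (b :: ms)) /= size_nseq; nia.
Qed.

(** * Capped prices of the favorable probabilities *)

Definition digit (x : sym) : bool := x != sep.

Lemma all_digit_bits s : all digit (bits s).
Proof. by elim: s. Qed.

Lemma encode_natE x : encode_nat x = bits (bits_of_nat x) ++ [:: sep].
Proof. by rewrite /encode_nat -cats1. Qed.

Definition skip_number : cmd 19 sym := discard digit $0 ;; Pop $0.

Lemma runs_skip_number x a0 l :
  runs skip_number (stacks ((encode_nat x ++ a0) :: l)) (stacks (a0 :: l))
    (2 * size (encode_nat x)).
Proof.
xrun.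
  eapply runs_seq.
    eapply (@runs_discard_st digit $0 _ (bits (bits_of_nat x)) (sep :: a0)) => //=.
    - by rewrite encode_natE -catA.
    - exact: all_digit_bits.
  by xlast.
by rewrite encode_natE size_cat /=; lia.
Qed.

Definition read_number : cmd 19 sym := transfer None digit $0 $1 ;; Pop $0.

Lemma runs_read_number x a0 l :
  runs read_number (stacks [:: encode_nat x ++ a0, [::] & l])
    (stacks [:: a0, bits (rev (bits_of_nat x)) & l]) (4 * size (encode_nat x)).
Proof.
xrun.
  eapply runs_seq.
    eapply (@runs_transfer_st digit $0 $1 _ (bits (bits_of_nat x)) (sep :: a0)) => //=.
    - by rewrite encode_natE -catA.
    - exact: all_digit_bits.
  by xlast; rewrite cats0 /bits map_rev.
by rewrite encode_natE size_cat /=; lia.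
Qed.

Definition truncate : cmd 19 sym :=
  While (fun h => nonempty $3 h && nonempty $4 h) (mov None $3 $2 ;; mov None $4 $5) ;;
  erase $3 ;; move_all $5 $4.

Lemma runs_truncate_loop a0 a1 v x w w' l :
  runs (While (fun h => nonempty $3 h && nonempty $4 h)
    (mov None $3 $2 ;; mov None $4 $5))
    (stacks [:: a0, a1, ones v, ones x, ones w, ones w' & l])
    (stacks [:: a0, a1, ones (minn x w + v), ones (x - w), ones (w - x), ones (minn x w + w') & l])
    (7 * w + 1).
Proof.
elim: w x v w' => [|w IH] [|x] v w'; [by rewrite minn0 subn0; xexit..| |].
  by apply: runs_le; [rewrite min0n subn0; xexit | lia].
xrun; first xloop.
- xstep. xlast. reflexivity.
- eapply runs_eq. apply: (IH x v.+1 w'.+1). by rewrite minnSS subSS !addnS.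
by lia.
Qed.

Lemma runs_truncate a0 a1 x w l :
  runs truncate (stacks [:: a0, a1, [::], ones x, ones w, [::] & l])
    (stacks [:: a0, a1, ones (minn w x), [::], ones w, [::] & l])
    (11 * w + 2 * x + 3).
Proof.
xrun.
  eapply runs_seq; first exact: (runs_truncate_loop _ _ 0 _ _ 0).
  xstep. xlast. rewrite rev_nseq -nseqD !addn0 minnC.
  by rewrite (_ : minn w x + (w - x) = w); [reflexivity | lia].
by rewrite !size_nseq; lia.
Qed.

(** A price may be exponential in the length of the input, so the unary accumulator is cut down to
    [w] after every digit. Nothing is lost, since [minn w (b + 2 * minn w v) = minn w (b + 2 *
    v)]. *)
Definition truncated_horner : cmd 19 sym :=
  While (nonempty $1)
    (double_unary ;; If (fun h => at_one (h $1)) (push $3 one) Nop ;; Pop $1 ;; truncate).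

Lemma runs_truncated_horner a0 ms v w l : 
  runs truncated_horner (stacks [:: a0, bits ms, ones (minn w v), [::], ones w, [::] & l])
    (stacks [:: a0, [::], ones (minn w (horner v ms)), [::], ones w, [::] & l])
    ((21 * w + 15) * size ms + 1).
Proof.
elim: ms v => [|b ms IH] v; first by rewrite muln0; xexit.
xrun; first eapply runs_whileT; first by [].
- eapply runs_seq; first exact: (runs_double _ _ _ 0).
  eapply (@runs_seq _ _ _ _ _ (stacks [:: a0, bits (b :: ms), [::],
      ones (b + 2 * minn w v), ones w, [::] & l])).
    rewrite addn0; case: b => /=.
      by eapply runs_ifT; [|xlast].
    by eapply runs_ifF; [|apply: runs_nop_le].
  xstep. eapply runs_eq; first exact: runs_truncate.
  rewrite (_ : minn w (b + 2 * minn w v) = minn w (b + 2 * v)); first by []; lia.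
- exact: IH.
by rewrite /=; have := geq_minl w v; nia.
Qed.

Lemma lsb_bits_of_nat x : lsb (bits_of_nat x) = x.
Proof.
rewrite /bits_of_nat -[RHS]bin_of_natK; case: bin_of_nat => //=.
by elim=> //= p ->; rewrite ?natTrecE; lia.
Qed.

(** The minimum found so far is the truncation bound for the next price, so truncating already takes
    the new minimum. *)
Definition min_price : cmd 19 sym :=
  read_number ;; truncated_horner ;; erase $4 ;; move_all $2 $4.

Lemma runs_min_price x a0 w l :
  runs min_price (stacks [:: encode_nat x ++ a0, [::], [::], [::], ones w, [::] & l])
    (stacks [:: a0, [::], [::], [::], ones (minn w x), [::] & l])
    ((27 * w + 22) * size (encode_nat x)).
Proof.
xrun.
  eapply runs_seq; first exact: runs_read_number.
  eapply runs_seq.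
    have := @runs_truncated_horner a0 (rev (bits_of_nat x)) 0 w l.
    rewrite minn0; apply.
  rewrite horner_rev lsb_bits_of_nat addn0.
  xstep. xlast. rewrite rev_nseq cats0. reflexivity.
rewrite !size_nseq encode_natE !size_cat /= size_rev /bits size_map.
by have := geq_minl w x; nia.
Qed.

Definition skip_prices : cmd 19 sym :=
  While (nonempty $6) (skip_number ;; mov None $6 $7) ;; move_all $7 $6.

Lemma encode_nats_cons x xs : encode_nats (x :: xs) = encode_nat x ++ encode_nats xs.
Proof. by []. Qed.

Lemma encode_nats_cat xs ys : encode_nats (xs ++ ys) = encode_nats xs ++ encode_nats ys.
Proof. by rewrite /encode_nats map_cat flatten_cat. Qed.

Lemma size_encode_nat x : 0 < size (encode_nat x).
Proof. by rewrite encode_natE size_cat addn1. Qed.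

Lemma size_encode_nats xs : size xs <= size (encode_nats xs).
Proof.
elim: xs => //= x xs IH; rewrite encode_nats_cons size_cat -add1n.
exact: leq_add (size_encode_nat x) IH.
Qed.

Lemma runs_skip_prices_loop xs a0 a1 a2 a3 a4 a5 q l :
  runs (While (nonempty $6) (skip_number ;; mov None $6 $7))
    (stacks [:: encode_nats xs ++ a0, a1, a2, a3, a4, a5, ones (size xs), ones q & l])
    (stacks [:: a0, a1, a2, a3, a4, a5, [::], ones (size xs + q) & l])
    (6 * size (encode_nats xs) + 1).
Proof.
elim: xs q => [|x xs IH] q; first by xexit.
xrun; first xloop.
- eapply runs_seq; first by rewrite encode_nats_cons -catA; exact: runs_skip_number.
  by xlast.
- eapply runs_eq; first exact: (IH q.+1). by rewrite addnS.
by rewrite encode_nats_cons size_cat; have := size_encode_nat x; lia.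
Qed.

Lemma runs_skip_prices xs a0 a1 a2 a3 a4 a5 l :
  runs skip_prices
    (stacks [:: encode_nats xs ++ a0, a1, a2, a3, a4, a5, ones (size xs), [::] & l])
    (stacks [:: a0, a1, a2, a3, a4, a5, ones (size xs), [::] & l])
    (10 * size (encode_nats xs) + 2).
Proof.
xrun.
  eapply runs_seq; first exact: (runs_skip_prices_loop _ _ _ _ _ _ _ 0).
  by xlast; rewrite addn0 rev_nseq cats0.
by rewrite addn0 size_nseq; have := size_encode_nats xs; lia.
Qed.

Definition min_prices : cmd 19 sym :=
  While (nonempty $8) (min_price ;; mov None $8 $9) ;; move_all $9 $8.

Lemma runs_min_prices_loop xs a0 w a6 a7 q l W : w <= W ->
  runs (While (nonempty $8) (min_price ;; mov None $8 $9))
    (stacks [:: encode_nats xs ++ a0, [::], [::], [::], ones w, [::], a6, a7,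
            ones (size xs), ones q & l])
    (stacks [:: a0, [::], [::], [::], ones (foldl minn w xs), [::], a6, a7,
            [::], ones (size xs + q) & l])
    ((27 * W + 26) * size (encode_nats xs) + 1).
Proof.
elim: xs q w => [|x xs IH] q w wW; first by rewrite muln0; xexit.
xrun; first xloop.
- eapply runs_seq; first by rewrite encode_nats_cons -catA; exact: runs_min_price.
  by xlast.
- eapply runs_eq; first by apply: (IH q.+1); apply: leq_trans (geq_minl w x) wW.
  by rewrite addnS.
by rewrite encode_nats_cons size_cat; have := size_encode_nat x; nia.
Qed.

Lemma runs_min_prices xs a0 w a6 a7 l W : w <= W ->
  runs min_prices
    (stacks [:: encode_nats xs ++ a0, [::], [::], [::], ones w, [::], a6, a7,
            ones (size xs), [::] & l])
    (stacks [:: a0, [::], [::], [::], ones (foldl minn w xs), [::], a6, a7,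
            ones (size xs), [::] & l])
    ((27 * W + 30) * size (encode_nats xs) + 2).
Proof.
move=> wW; xrun.
  eapply runs_seq; first exact: (runs_min_prices_loop _ _ _ _ 0 _ wW).
  by xlast; rewrite addn0 rev_nseq cats0.
by rewrite addn0 size_nseq; have := size_encode_nats xs; lia.
Qed.

(* [a1] is one more than the largest index that misses the threshold, and [c] is
   the number of the remaining indices. *)
Definition capped_price (a1 c cap : nat) (z : bool) (prices : seq nat) : nat :=
  foldl minn cap (if z then drop a1 prices else take c prices).

(* Registers 6, 8 and 10 hold [a1], [c] and the cap in unary, register 13 holds
   the targets; the capped prices are collected in reverse order in register 11. *)
Definition cell : cmd 19 sym :=
  skip_number ;; skip_number ;; copy None $10 $4 $5 ;;
  If (fun h => at_one (h $13)) (skip_prices ;; min_prices) (min_prices ;; skip_prices) ;;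
  mov None $13 $14 ;; move_all $4 $11 ;; push $11 zero.

Lemma foldl_minn_le cap xs : foldl minn cap xs <= cap.
Proof. by elim: xs cap => //= x xs IH cap; apply: leq_trans (IH _) (geq_minl _ _). Qed.

(** The favorable values form an upper segment of [c] indices for target 1 and, by reflection, a
    lower segment of [c] indices for target 0. The other [a1] prices are skipped, so the same two
    counters serve both cases, in opposite orders. *)
Lemma runs_cell p1 p2 prices a0 a1 c cap a11 a12 z zs a14 l :
  size prices = a1 + c ->
  runs cell
    (stacks [:: encode_nats [:: p1, p2 & prices] ++ a0, [::], [::], [::], [::], [::],
            ones a1, [::], ones c, [::], ones cap, a11, a12, Some z :: zs, a14 & l])
    (stacks [:: a0, [::], [::], [::], [::], [::],
            ones a1, [::], ones c, [::], ones cap,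
            zero :: ones (capped_price a1 c cap z prices) ++ a11, a12, zs, Some z :: a14 & l])
    ((41 * cap + 60) * size (encode_nats [:: p1, p2 & prices])).
Proof.
move=> sp.
have Hif : runs (If (fun h => at_one (h $13)) (skip_prices ;; min_prices) (min_prices ;; skip_prices))
    (stacks [:: encode_nats prices ++ a0, [::], [::], [::], ones cap, [::],
            ones a1, [::], ones c, [::], ones cap, a11, a12, Some z :: zs, a14 & l])
    (stacks [:: a0, [::], [::], [::], ones (capped_price a1 c cap z prices), [::],
            ones a1, [::], ones c, [::], ones cap, a11, a12, Some z :: zs, a14 & l])
    ((27 * cap + 30) * size (encode_nats prices) + 5).
  rewrite /capped_price; case: z.
  - have [sd tz] : size (drop a1 prices) = c /\ size (take a1 prices) = a1.
      by rewrite size_drop size_take_min; lia.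
    move: sd tz; rewrite -{3 5}(cat_take_drop a1 prices) encode_nats_cat -catA.
    move: (take _ _) (drop _ _) => p q <- <-.
    xrun; first eapply runs_ifT; first by [].
      eapply runs_seq; first exact: runs_skip_prices.
      exact: (@runs_min_prices _ _ _ _ _ _ cap).
    by rewrite size_cat; nia.
  - have [sd tz] : size (drop c prices) = a1 /\ size (take c prices) = c.
      by rewrite size_drop size_take_min; lia.
    move: sd tz; rewrite -{3 5}(cat_take_drop c prices) encode_nats_cat -catA.
    move: (take _ _) (drop _ _) => p q <- <-.
    xrun; first eapply runs_ifF; first by [].
      eapply runs_seq; first exact: (@runs_min_prices _ _ _ _ _ _ cap).
      exact: runs_skip_prices.
    by rewrite size_cat; nia.
xrun.
  rewrite !encode_nats_cons -!catA.
  eapply runs_seq; first exact: runs_skip_number.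
  eapply runs_seq; first exact: runs_skip_number.
  xstep; rewrite cats0.
  eapply runs_seq; first exact: Hif.
  xstep. xstep. xlast. rewrite rev_nseq. reflexivity.
rewrite !size_nseq !encode_nats_cons !size_cat.
have := foldl_minn_le cap (if z then drop a1 prices else take c prices).
rewrite -/(capped_price _ _ _ _ _).
by have := size_encode_nat p1; have := size_encode_nat p2; nia.
Qed.

(** Since every unary entry is closed by [zero], no row word is a proper prefix of another one with
    equally many entries ([prefix_row_word]), so a prefix test decides equality of rows. The symbol
    [sep] remains free for amounts and for the ends of rows. *)
Definition row_word (ws : seq nat) : seq sym := flatten [seq rcons (ones w) zero | w <- ws].

Lemma row_word_cons w ws : row_word (w :: ws) = ones w ++ zero :: row_word ws.
Proof. by rewrite /row_word /= cat_rcons. Qed.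

Definition table_word (rows : seq (seq nat)) : seq sym :=
  flatten [seq rcons (row_word ws) sep | ws <- rows].

Lemma table_word_cons ws rows :
  table_word (ws :: rows) = row_word ws ++ sep :: table_word rows.
Proof. by rewrite /table_word /= cat_rcons. Qed.

(* The numbers that describe a voter on an issue: the numerator and the
   denominator of the probability, and the prices. *)
Definition cell_numbers (c : nat * nat * seq nat) : seq nat := [:: c.1.1, c.1.2 & c.2].

Definition row_numbers (cs : seq (nat * nat * seq nat)) : seq nat :=
  flatten (map cell_numbers cs).

Lemma size_row_numbers cs : size cs <= size (row_numbers cs).
Proof.
elim: cs => // x xs IH; rewrite -[row_numbers _]/(cell_numbers x ++ row_numbers xs).
by rewrite size_cat /=; lia.
Qed.

Definition capped_row (a1 c cap : nat) (zs : seq bool) (cs : seq (nat * nat * seq nat)) :=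
  [seq capped_price a1 c cap zc.1 zc.2.2 | zc <- zip zs cs].

Definition row_prog : cmd 19 sym :=
  While (nonempty $13) cell ;; move_all $14 $13 ;; push $11 sep.

Lemma runs_cells cs zs a0 a1 c cap a11 a12 a14 l :
  size zs = size cs -> all (fun x => size x.2 == a1 + c) cs ->
  runs (While (nonempty $13) cell)
    (stacks [:: encode_nats (row_numbers cs) ++ a0, [::], [::], [::], [::], [::],
            ones a1, [::], ones c, [::], ones cap, a11, a12, bits zs, a14 & l])
    (stacks [:: a0, [::], [::], [::], [::], [::],
            ones a1, [::], ones c, [::], ones cap,
            rev (row_word (capped_row a1 c cap zs cs)) ++ a11, a12, [::],
            rev (bits zs) ++ a14 & l])
    ((41 * cap + 61) * size (encode_nats (row_numbers cs)) + 1).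
Proof.
elim: cs zs a11 a14 => [|[[p1 p2] ps] cs IH] [|z zs] a11 a14 //=.
  by move=> _ _; rewrite muln0; xexit.
move=> [szs] /andP[/eqP sp ap].
rewrite /row_numbers -[map _ _]/([:: p1, p2 & ps] :: map cell_numbers cs).
rewrite -[flatten _]/([:: p1, p2 & ps] ++ row_numbers cs) encode_nats_cat -catA.
xrun; first xloop.
- exact: runs_cell.
- eapply runs_eq; first exact: IH.
  rewrite /capped_row /= -/(capped_row _ _ _ _ _) row_word_cons !rev_cat !rev_cons.
  by rewrite -!cats1 -!catA rev_nseq.
by rewrite size_cat !encode_nats_cons size_cat; have := size_encode_nat p1; nia.
Qed.

Lemma runs_row cs zs a0 a1 c cap a11 a12 l :
  0 < size cs -> size zs = size cs -> all (fun x => size x.2 == a1 + c) cs ->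
  runs row_prog
    (stacks [:: encode_nats (row_numbers cs) ++ a0, [::], [::], [::], [::], [::],
            ones a1, [::], ones c, [::], ones cap, a11, a12, bits zs, [::] & l])
    (stacks [:: a0, [::], [::], [::], [::], [::],
            ones a1, [::], ones c, [::], ones cap,
            rev (rcons (row_word (capped_row a1 c cap zs cs)) sep) ++ a11, a12, bits zs,
            [::] & l])
    ((41 * cap + 70) * size (encode_nats (row_numbers cs))).
Proof.
move=> c0 szs ap.
xrun.
  eapply runs_seq; first exact: runs_cells.
  xstep. xlast. by rewrite !cats0 revK rev_rcons.
rewrite cats0 size_rev size_map.
have : size zs <= size (encode_nats (row_numbers cs)).
  apply: leq_trans (size_encode_nats _).
  by rewrite szs; apply: size_row_numbers.
by nia.
Qed.

Lemma size_rows_numbers n css : all (fun cs => n == size cs) css ->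
  n * size css <= size (flatten (map row_numbers css)).
Proof.
elim: css => [|cs css IH] /=; first by rewrite muln0.
move=> /andP[/eqP e /IH {}IH]; rewrite size_cat mulnS leq_add //.
by rewrite e size_row_numbers.
Qed.

(** The number of voters is not consulted: each pass consumes one row of the input, and the loop
    stops at the end of the input. Progress requires at least one issue. *)
Definition rows_prog : cmd 19 sym := While (nonempty $0) row_prog ;; move_all $11 $12.

Lemma runs_rows_loop css zs a1 c cap a11 a12 l :
  0 < size zs ->
  all (fun cs => size zs == size cs) css ->
  all (all (fun x => size x.2 == a1 + c)) css ->
  runs (While (nonempty $0) row_prog)
    (stacks [:: encode_nats (flatten (map row_numbers css)), [::], [::], [::], [::], [::],
            ones a1, [::], ones c, [::], ones cap, a11, a12, bits zs, [::] & l])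
    (stacks [:: [::], [::], [::], [::], [::], [::],
            ones a1, [::], ones c, [::], ones cap,
            rev (table_word (map (capped_row a1 c cap zs) css)) ++ a11, a12, bits zs,
            [::] & l])
    ((41 * cap + 71) * size (encode_nats (flatten (map row_numbers css))) + 1).
Proof.
move=> z0; elim: css a11 => [|cs css IH] a11 /=.
  by rewrite muln0 => _ _; xexit.
move=> /andP[/eqP scs acs] /andP[sz asz].
have sr : 0 < size (encode_nats (row_numbers cs)).
  apply: leq_trans (size_encode_nats _).
  by move: z0; rewrite scs; case: (cs).
rewrite encode_nats_cat.
xrun; first eapply runs_whileT.
- by rewrite /=; case: encode_nats sr.
- by apply: runs_row => //; rewrite -scs.
- eapply runs_eq; first exact: IH.
  by rewrite table_word_cons !rev_cat rev_cons rev_rcons -!cats1 -!catA.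
by rewrite size_cat; nia.
Qed.

Lemma size_row_word ws cap : all (leq^~ cap) ws -> size (row_word ws) <= cap.+1 * size ws.
Proof.
elim: ws => //= w ws IH /andP[wc /IH]; rewrite row_word_cons size_cat /= size_nseq; nia.
Qed.

Lemma size_table_word rows cap n : all (all (leq^~ cap)) rows ->
  all (fun ws => size ws == n) rows ->
  size (table_word rows) <= (cap.+1 * n).+1 * size rows.
Proof.
elim: rows => //= ws rows IH /andP[wc /IH {}IH] /andP[/eqP sn /IH {}IH].
rewrite table_word_cons size_cat /=; have := size_row_word wc; rewrite sn; nia.
Qed.

Lemma capped_row_le a1 c cap zs cs : all (leq^~ cap) (capped_row a1 c cap zs cs).
Proof. by apply/allP => _ /mapP[x _ ->]; apply: foldl_minn_le. Qed.

Lemma size_capped_row a1 c cap zs cs :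
  size zs = size cs -> size (capped_row a1 c cap zs cs) = size zs.
Proof. by move=> e; rewrite size_map size_zip e minnn. Qed.

Lemma runs_rows css zs a1 c cap l :
  0 < size zs ->
  all (fun cs => size zs == size cs) css ->
  all (all (fun x => size x.2 == a1 + c)) css ->
  runs rows_prog
    (stacks [:: encode_nats (flatten (map row_numbers css)), [::], [::], [::], [::], [::],
            ones a1, [::], ones c, [::], ones cap, [::], [::], bits zs, [::] & l])
    (stacks [:: [::], [::], [::], [::], [::], [::],
            ones a1, [::], ones c, [::], ones cap, [::],
            table_word (map (capped_row a1 c cap zs) css), bits zs,
            [::] & l])
    ((45 * cap + 80) * size (encode_nats (flatten (map row_numbers css))) + 2).
Proof.
move=> z0 acs asz.
xrun.
  eapply runs_seq; first exact: runs_rows_loop.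
  by xlast; rewrite !cats0 revK.
rewrite cats0 size_rev.
have /= := @size_table_word (map (capped_row a1 c cap zs) css) cap (size zs).
rewrite !all_map size_map.
have -> : all (preim (capped_row a1 c cap zs) (all (leq^~ cap))) css.
  by apply/allP => cs _; apply: capped_row_le.
have -> : all (preim (capped_row a1 c cap zs) (fun ws => size ws == size zs)) css.
  by apply/allP => cs /(allP acs) /eqP e; rewrite /= size_capped_row.
move=> /(_ isT isT).
have := leq_trans (size_rows_numbers acs) (size_encode_nats _).
by nia.
Qed.

(** * Checking a guess *)

Local Notation seps n := (nseq n sep).

(** All separators of the guess are charged, also those that no voter will claim; the excess goes to
    the register of violations. *)
Definition budget_loop : cmd 19 sym :=
  While (nonempty $0)
    (If (fun h => h $0 == Some sep) (If (nonempty $2) (Pop $2) (push $3 one)) Nop ;; Pop $0).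

Lemma runs_budget_loop g a1 b bad l :
  runs budget_loop (stacks [:: g, a1, ones b, ones bad & l])
    (stacks [:: [::], a1, ones (b - count_mem sep g), ones (bad + (count_mem sep g - b)) & l])
    (6 * size g + 1).
Proof.
elim: g b bad => [|x g IH] b bad; first by rewrite /= subn0 addn0; xexit.
xrun; first xloop.
- eapply (@runs_seq _ _ _ _ _ (stacks [:: x :: g, a1, ones (b - (x == sep)),
            ones (bad + ((x == sep) - b)) & l]) _ 4).
    case: x => [x|] /=.
      by eapply runs_ifF; [|apply: runs_nop_le; rewrite ?subn0 ?addn0].
    eapply runs_ifT => //; case: b => [|b].
      by eapply runs_ifF => //; xlast; rewrite addn1.
    eapply runs_ifT => //; apply: runs_le; first xlast.
      by rewrite subn1 addn0.
    by [].
  by xlast.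
- eapply runs_eq; first exact: IH.
  by rewrite /=; congr (stacks [:: _, _, ones _, ones _ & _]); lia.
by rewrite /=; lia.
Qed.

(** Differences are counted rather than detected once because the loop has to carry the whole row
    over to register 7 anyway. An exhausted guess differs at every remaining position. *)
Fixpoint mismatches (r g : seq sym) : nat :=
  if r is x :: r' then (Some x != ohead g) + mismatches r' (behead g) else 0.

Definition compare_loop : cmd 19 sym :=
  While (top_is digit $4)
    (If (fun h => h $4 == h $0) Nop (push $5 one) ;; mov None $4 $7 ;;
     If (nonempty $0) (mov None $0 $1) Nop).

Lemma runs_compare_loop r rest g g' a2 a3 d a6 w' l : all digit r ->
  runs compare_loop
    (stacks [:: g, g', a2, a3, r ++ sep :: rest, ones d, a6, w' & l])
    (stacks [:: drop (size r) g, rev (take (size r) g) ++ g', a2, a3, sep :: rest,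
            ones (mismatches r g + d), a6, rev r ++ w' & l])
    (11 * size r + 1).
Proof.
elim: r g g' d w' => [|x r IH] g g' d w' /=; first by move=> _; rewrite drop0 take0; xexit.
move=> /andP[dx dr].
xrun; first eapply runs_whileT; first by rewrite /= dx.
- eapply (@runs_seq _ _ _ _ _ (stacks [:: g, g', a2, a3, x :: r ++ sep :: rest,
      ones ((Some x != ohead g) + d), a6, w' & l]) _ 3).
    case: (boolP (Some x == ohead g)) => xg.
      by eapply runs_ifT => //=; apply: runs_nop_le.
    by eapply runs_ifF => //=; xlast.
  xstep.
  (* Writing [take 1 g] covers both an exhausted guess, where nothing is moved, and a nonempty
     one. *)
  instantiate (2 := stacks [:: behead g, rev (take 1 g) ++ g', a2, a3, r ++ sep :: rest,
      ones ((Some x != ohead g) + d), a6, x :: w' & l]).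
  instantiate (1 := 4).
  case: g => [|y g].
    by eapply runs_ifF => //=; apply: runs_nop_le.
  by eapply runs_ifT => //=; xlast; rewrite take0.
- eapply runs_eq; first exact: IH.
  rewrite addnCA addnA -cat_rcons -rev_cons.
  congr (stacks [:: _, _, _, _, _, _, _, _ & _]).
    by case: (g) => [|y g1].
  by case: (g) => [|y g1] //=; rewrite take0 -cat_rcons -rev_cons.
by lia.
Qed.

Lemma mismatches_le r g : mismatches r g <= size r.
Proof. by elim: r g => //= x r IH g; have := IH (behead g); lia. Qed.

Lemma mismatches_eq0 r g : (mismatches r g == 0) = prefix r g.
Proof.
elim: r g => [|x r IH] [|y g] //=.
by rewrite addn_eq0 IH eqb0 negbK.
Qed.

(* A guess is a sequence of slots, each made of [e] separators followed by a row
   word.  A voter whose row word agrees with the first remaining slot consumes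
   it and is paid the amount [e]; all other voters are paid nothing. *)
Fixpoint payments (g : seq sym) (rows : seq (seq sym)) : seq nat :=
  if rows is r :: rows' then
    let e := find digit g in
    if prefix r (drop e g) then e :: payments (drop (size r) (drop e g)) rows'
    else 0 :: payments g rows'
  else [::].

Fixpoint leftover (g : seq sym) (rows : seq (seq sym)) : seq sym :=
  if rows is r :: rows' then
    let e := find digit g in
    if prefix r (drop e g) then leftover (drop (size r) (drop e g)) rows'
    else leftover g rows'
  else g.

(** The comparison uses up the guess; registers 2 and 1 keep the separators and the symbols read
    after them, so that a mismatch can put them back. *)
Definition pay_voter : cmd 19 sym :=
  transfer None (pred1 sep) $0 $2 ;; compare_loop ;; mov None $4 $7 ;;
  If (nonempty $5) (erase $5 ;; move_all $1 $0 ;; move_all $2 $0) (erase $1) ;;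
  move_all $2 $6 ;; push $6 zero.

Lemma take_find_digit g : take (find digit g) g = seps (find digit g).
Proof. by elim: g => //= -[x|] g IH //=; rewrite IH. Qed.

Lemma runs_pay_voter r rest g a3 a6 w' l : all digit r ->
  let e := find digit g in let g1 := drop e g in
  let g2 := if prefix r g1 then drop (size r) g1 else g in
  let e2 := if prefix r g1 then e else 0 in
  runs pay_voter
    (stacks [:: g, [::], [::], a3, r ++ sep :: rest, [::], a6, w' & l])
    (stacks [:: g2, [::], [::], a3, rest, [::],
            zero :: seps e2 ++ a6, sep :: rev r ++ w' & l])
    (17 * size r + 16 * size g + 20).
Proof.
move=> dr e g1 g2 e2.
have se : size (take e g) = e by rewrite take_find_digit size_nseq.
have le_e : e <= size g by apply: find_size.
have sg1 : size g1 <= size g by rewrite size_drop leq_subr.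
have Hif : runs
   (If (nonempty $5) (erase $5 ;; move_all $1 $0 ;; move_all $2 $0) (erase $1))
   (stacks [:: drop (size r) g1, rev (take (size r) g1), seps e, a3, rest,
      ones (mismatches r g1), a6, sep :: rev r ++ w' & l])
   (stacks [:: g2, [::], seps e2, a3, rest, [::], a6, sep :: rev r ++ w' & l])
   (2 * size r + 8 * size g + 5).
  rewrite /g2 /e2 -mismatches_eq0; case: eqP => [->|/eqP m0].
    xrun; first eapply runs_ifF; first by [].
      by eapply runs_eq; first xcmd.
    by rewrite /= size_rev size_take_min; lia.
  xrun; first eapply runs_ifT; first by rewrite /=; case: mismatches m0.
    xstep. xstep. rewrite revK cat_take_drop. xlast.
    by rewrite rev_nseq -take_find_digit cat_take_drop.
  rewrite /= size_rev !size_nseq size_take_min.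
  by have := mismatches_le r g1; lia.
xrun.
  eapply runs_seq.
    eapply (@runs_transfer_st (pred1 sep) $0 $2 _ (take e g) g1) => //.
    - by rewrite cat_take_drop.
    - by rewrite take_find_digit all_nseq orbT.
    - rewrite /g1 /e; elim: (g) => //= -[x|] g3 //=.
  rewrite /= cats0 take_find_digit rev_nseq.
  eapply runs_seq; first exact: (runs_compare_loop _ _ _ _ _ 0).
  xstep. rewrite addn0 cats0.
  eapply runs_seq; first exact: Hif.
  by xstep; xlast; rewrite rev_nseq.
rewrite size_nseq.
have : e2 <= e by rewrite /e2; case: ifP.
by rewrite /= take_find_digit !size_nseq; lia.
Qed.

Definition payment_word (es : seq nat) : seq sym := flatten [seq rcons (seps e) zero | e <- es].

Lemma payment_word_cons e es : payment_word (e :: es) = seps e ++ zero :: payment_word es.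
Proof. by rewrite /payment_word /= cat_rcons. Qed.

Definition words (rs : seq (seq sym)) : seq sym := flatten [seq rcons r sep | r <- rs].

Lemma words_cons r rs : words (r :: rs) = r ++ sep :: words rs.
Proof. by rewrite /words /= cat_rcons. Qed.

Definition pay_voters : cmd 19 sym := While (nonempty $4) pay_voter.

Lemma runs_pay_voters rs g a3 a6 w' l N : all (all digit) rs -> size g <= N ->
  runs pay_voters
    (stacks [:: g, [::], [::], a3, words rs, [::], a6, w' & l])
    (stacks [:: leftover g rs, [::], [::], a3, [::], [::],
        rev (payment_word (payments g rs)) ++ a6, rev (words rs) ++ w' & l])
    ((16 * N + 21) * size (words rs) + 1).
Proof.
elim: rs g a6 w' => [|r rs IH] g a6 w' /=; first by rewrite muln0 => _ _; xexit.
move=> /andP[dr drs] gN.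
have H := runs_pay_voter (words rs) g a3 a6 w' l dr.
xrun; first eapply runs_whileT; first by rewrite words_cons; case: (r).
- rewrite words_cons. exact: H.
- eapply runs_eq; first apply: IH => //.
    case: ifP => // _; apply: leq_trans gN.
    by rewrite !size_drop; apply: leq_trans (leq_subr _ _) (leq_subr _ _).
  rewrite words_cons; case: ifP => _; rewrite payment_word_cons !rev_cat !rev_cons;
  by rewrite -!cats1 -!catA ?rev_nseq.
rewrite words_cons size_cat /=; nia.
Qed.

(** * Majorities, issue by issue *)

Definition column_entry : cmd 19 sym :=
  While (fun h => at_one (h $4) && (h $5 == Some sep)) (Pop $4 ;; mov None $5 $6) ;;
  If (fun h => h $4 == Some zero) (push $8 one) (push $9 one) ;;
  discard (pred1 one) $4 ;; Pop $4 ;;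
  transfer None (pred1 sep) $5 $6 ;; mov None $5 $6 ;;
  transfer None digit $4 $7 ;; mov None $4 $7.

Lemma cat_nseq_cons (A : Type) n (x : A) s : nseq n x ++ x :: s = nseq n.+1 x ++ s.
Proof. by elim: n => //= n ->. Qed.

(** Cancelling [w] against [e] unit by unit leaves [zero] on top of register 4 exactly when
    [w <= e]. The cancelled separators are saved in register 6 because the payments are needed again
    for the next issue. *)
Lemma runs_column_compare a0 a1 a2 a3 w r e es a6 l :
  runs (While (fun h => at_one (h $4) && (h $5 == Some sep)) (Pop $4 ;; mov None $5 $6))
    (stacks [:: a0, a1, a2, a3, ones w ++ zero :: r, seps e ++ zero :: es, a6 & l])
    (stacks [:: a0, a1, a2, a3, ones (w - e) ++ zero :: r, seps (e - w) ++ zero :: es,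
            seps (minn w e) ++ a6 & l])
    (5 * w + 1).
Proof.
elim: w e a6 => [|w IH] [|e] a6; [by rewrite min0n; xexit| by rewrite min0n; xexit | |].
  by rewrite minn0; apply: (@runs_le _ _ _ _ _ 1); [xexit | lia].
xrun; first xloop.
- by xstep; xlast.
- eapply runs_eq; first exact: (IH e).
  by rewrite minnSS !subSS cat_nseq_cons.
by lia.
Qed.

Lemma all_digit_row_word ws : all digit (row_word ws).
Proof. by elim: ws => // w ws IH; rewrite row_word_cons all_cat all_nseq orbT. Qed.

Lemma runs_column_entry a0 a1 a2 a3 w ws rest e es a6 a7 p q l :
  runs column_entry
    (stacks [:: a0, a1, a2, a3, row_word (w :: ws) ++ sep :: rest, payment_word (e :: es),
            a6, a7, ones p, ones q & l])
    (stacks [:: a0, a1, a2, a3, rest, payment_word es,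
            rev (rcons (seps e) zero) ++ a6, rev (rcons (row_word ws) sep) ++ a7,
            ones ((w <= e) + p), ones (~~ (w <= e) + q) & l])
    (7 * size (row_word (w :: ws)) + 4 * e + 20).
Proof.
rewrite row_word_cons payment_word_cons -catA /=.
xrun.
  eapply runs_seq; first exact: runs_column_compare.
  eapply (@runs_seq _ _ _ _ _ (stacks [:: a0, a1, a2, a3,
      ones (w - e) ++ zero :: row_word ws ++ sep :: rest,
      seps (e - w) ++ zero :: payment_word es,
      seps (minn w e) ++ a6, a7,
      ones ((w <= e) + p), ones (~~ (w <= e) + q) & l]) _ 3).
    rewrite /leq; case: (w - e) => [|d] /=.
      by eapply runs_ifT; [|xlast].
    by eapply runs_ifF; [|xlast].
  eapply runs_seq.
    eapply (@runs_discard_st (pred1 one) $4 _ (ones (w - e))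
              (zero :: row_word ws ++ sep :: rest)) => //.
    by rewrite all_nseq orbT.
  xstep.
  eapply runs_seq.
    eapply (@runs_transfer_st (pred1 sep) $5 $6 _ (seps (e - w)) (zero :: payment_word es)) => //.
    by rewrite all_nseq orbT.
  rewrite /=; xstep.
  eapply runs_seq.
    eapply (@runs_transfer_st digit $4 $7 _ (row_word ws) (sep :: rest)) => //.
    exact: all_digit_row_word.
  rewrite /=; xlast.
  by rewrite !rev_rcons !rev_nseq catA -nseqD (_ : e - w + minn w e = e); last by lia.
by rewrite !size_nseq size_cat /= size_nseq; lia.
Qed.

(** Each pass strips the first entry off every row, so the same code then treats the next issue.
    Cancelling register 9 against register 8 leaves register 8 nonempty exactly for a strict
    majority. *)
Definition column_pass : cmd 19 sym :=
  While (nonempty $4) column_entry ;; move_all $7 $4 ;; move_all $6 $5 ;;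
  While (nonempty $9) (Pop $9 ;; Pop $8) ;;
  If (nonempty $8) (erase $8) (push $3 one).

Definition favorable (rows : seq (seq nat)) (es : seq nat) : seq bool :=
  [seq head 0 we.1 <= we.2 | we <- zip rows es].

Lemma table_wordE rows : table_word rows = words (map row_word rows).
Proof. by rewrite /words -map_comp. Qed.

Lemma runs_column_entries a0 a1 a2 a3 (rows : seq (seq nat)) es a6 a7 p q l :
  size rows = size es -> all (fun ws => ws != [::]) rows ->
  runs (While (nonempty $4) column_entry)
    (stacks [:: a0, a1, a2, a3, table_word rows, payment_word es, a6, a7, ones p, ones q & l])
    (stacks [:: a0, a1, a2, a3, [::], [::], rev (payment_word es) ++ a6,
            rev (table_word (map behead rows)) ++ a7,
            ones (count id (favorable rows es) + p),
            ones (count negb (favorable rows es) + q) & l])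
    (21 * size (table_word rows) + 4 * size (payment_word es) + 1).
Proof.
elim: rows es a6 a7 p q => [|[|w ws] rows IH] [|e es] a6 a7 p q //=.
  by move=> _ _; xexit.
move=> [sr] ar; rewrite table_word_cons.
xrun; first eapply runs_whileT.
- by rewrite /= row_word_cons; case: (w).
- exact: runs_column_entry.
- eapply runs_eq; first exact: IH.
  rewrite table_word_cons payment_word_cons !rev_cat !rev_rcons !rev_cons -!cats1 -!catA.
  by congr (stacks [:: _, _, _, _, _, _, _, _, ones _, ones _ & _]);
    rewrite /favorable /= addnCA addnA.
by rewrite payment_word_cons !size_cat /= size_nseq; lia.
Qed.

Lemma runs_balance l7 p q l : size l7 = 8 ->
  runs (While (nonempty $9) (Pop $9 ;; Pop $8)) (stacks (l7 ++ [:: ones p, ones q & l]))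
    (stacks (l7 ++ [:: ones (p - q), [::] & l])) (3 * q + 1).
Proof.
case: l7 => [|x0 [|x1 [|x2 [|x3 [|x4 [|x5 [|x6 [|x7 [|]]]]]]]]] //= _.
elim: q p => [|q IH] p; first by rewrite subn0; xexit.
xrun; first xloop.
- by xstep; xlast.
- rewrite (_ : behead _ = ones p.-1); last by case: (p).
  by eapply runs_eq; [exact: IH | rewrite -subn1 -subnDA].
by lia.
Qed.

Definition majority (rows : seq (seq nat)) (es : seq nat) : bool :=
  size rows < 2 * count id (favorable rows es).

Lemma size_payment_word es : size (payment_word es) = sumn es + size es.
Proof. by elim: es => //= e es IH; rewrite payment_word_cons size_cat size_nseq /= IH; lia. Qed.

Lemma size_words_behead rows :
  size (table_word (map behead rows)) <= size (table_word rows).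
Proof.
elim: rows => // ws rows IH; rewrite /= !table_word_cons !size_cat /=.
by case: ws => [|w ws] /=; rewrite ?row_word_cons ?size_cat /=; lia.
Qed.

Lemma size_rows_table rows : size rows <= size (table_word rows).
Proof. by elim: rows => // ws rows IH; rewrite table_word_cons size_cat /=; lia. Qed.

Lemma runs_column_pass a0 a1 a2 bad (rows : seq (seq nat)) es l :
  size rows = size es -> all (fun ws => ws != [::]) rows ->
  runs column_pass
    (stacks [:: a0, a1, a2, ones bad, table_word rows, payment_word es, [::], [::], [::], [::] & l])
    (stacks [:: a0, a1, a2, ones (~~ majority rows es + bad),
            table_word (map behead rows), payment_word es, [::], [::], [::], [::] & l])
    (30 * size (table_word rows) + 8 * size (payment_word es) + 10).
Proof.
move=> sr ar; set p := count id (favorable rows es); set q := count negb (favorable rows es).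
have pq : p + q = size rows.
  by rewrite /p /q count_predC size_map size_zip sr minnn.
xrun.
  eapply runs_seq; first by apply: (@runs_column_entries _ _ _ _ _ _ _ _ 0 0).
  rewrite !addn0 !cats0 -/p -/q.
  xstep. xstep. rewrite !revK.
  eapply runs_seq; first exact: (@runs_balance [:: _; _; _; _; _; _; _; _]).
  instantiate (1 := 2 * p + 3).
  rewrite /= /majority -/p -pq (_ : (p + q < 2 * p) = (0 < p - q)); last by lia.
  case E : (p - q) => [|d].
    by eapply runs_le; [eapply runs_ifF; [|xlast; rewrite ?cats0] | lia].
  eapply runs_le; first by eapply runs_ifT; [|xlast; rewrite ?cats0].
  by rewrite /= size_nseq; lia.
rewrite /= !size_rev.
have := size_words_behead rows; have := size_rows_table rows; lia.
Qed.

Fixpoint won_columns (n : nat) (rows : seq (seq nat)) (es : seq nat) : seq bool :=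
  if n is n'.+1 then majority rows es :: won_columns n' (map behead rows) es else [::].

Definition column_passes : cmd 19 sym := While (nonempty $10) (column_pass ;; Pop $10).

Lemma runs_column_passes a0 a1 a2 bad n (rows : seq (seq nat)) es l :
  size rows = size es -> all (fun ws => size ws == n) rows ->
  runs column_passes
    (stacks [:: a0, a1, a2, ones bad, table_word rows, payment_word es, [::], [::], [::], [::],
           ones n & l])
    (stacks [:: a0, a1, a2, ones (count negb (won_columns n rows es) + bad),
            table_word (iter n (map behead) rows), payment_word es, [::], [::], [::], [::],
            [::] & l])
    ((30 * size (table_word rows) + 8 * size (payment_word es) + 12) * n + 1).
Proof.
elim: n rows bad => [|n IH] rows bad sr ar; first by rewrite muln0; xexit.
xrun; first xloop.
- eapply runs_seq; first apply: runs_column_pass => //.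
    by apply: sub_all ar => -[|w ws].
  xlast. reflexivity.
- eapply runs_eq; first apply: IH.
  + by rewrite size_map.
  + by rewrite all_map; apply: sub_all ar => -[|w ws].
  by rewrite -iterSr /= addnCA addnA.
by have := size_words_behead rows; nia.
Qed.

(** * Enumerating the guesses *)

Definition accepts (b n : nat) (rows : seq (seq nat)) (g : seq sym) : bool :=
  (count_mem sep g <= b) && all id (won_columns n rows (payments g (map row_word rows))).

Lemma size_payments g rs : size (payments g rs) = size rs.
Proof. by elim: rs g => //= r rs IH g; case: ifP => _; rewrite /= IH. Qed.

(** The separators paid to a voter leave the guess together with the slot, so different payments are
    charged to different separators, in malformed guesses too. *)
Lemma sumn_payments g rs : sumn (payments g rs) <= count_mem sep g.
Proof.
elim: rs g => //= r rs IH g; case: ifP => _ /=; last exact: IH.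
have E : count_mem sep g = find digit g + count_mem sep (drop (find digit g) g).
  rewrite -[in LHS](cat_take_drop (find digit g) g) count_cat take_find_digit.
  by rewrite count_nseq /= mul1n.
rewrite E leq_add2l; apply: leq_trans (IH _) _.
by rewrite -[in leqRHS](cat_take_drop (size r) (drop _ g)) count_cat leq_addl.
Qed.

Lemma size_leftover g rs : size (leftover g rs) <= size g.
Proof.
elim: rs g => //= r rs IH g; case: ifP => _ //.
by apply: leq_trans (IH _) _; rewrite !size_drop -subnDA leq_subr.
Qed.

Lemma count_sep_size (g : seq sym) : count_mem sep g <= size g.
Proof. exact: count_size. Qed.

(* Register 12 holds the rows, 15 the number of issues, 17 the guess, 18 the
   amount to be shared, and 19 becomes nonempty when a guess is accepted.
   Register 3 collects the violations. *)
Definition check_guess : cmd 19 sym :=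
  copy None $17 $0 $1 ;; copy None $18 $2 $1 ;; budget_loop ;; erase $2 ;;
  copy None $17 $0 $1 ;; copy None $12 $4 $1 ;; pay_voters ;; erase $0 ;;
  move_all $7 $4 ;; move_all $6 $5 ;;
  copy None $15 $10 $6 ;; column_passes ;; erase $4 ;; erase $5 ;;
  If (nonempty $3) (erase $3) (push $19 one).

Lemma count_negb_eq0 (s : seq bool) : (count negb s == 0) = all id s.
Proof. by elim: s => //= -[]. Qed.

Lemma won_columns_size n rows es : size (won_columns n rows es) = n.
Proof. by elim: n rows => //= n IH rows; rewrite IH. Qed.

Lemma size_iter_behead n rows :
  size (table_word (iter n (map behead) rows)) <= size (table_word rows).
Proof. by elim: n => //= n IH; apply: leq_trans (size_words_behead _) IH. Qed.

Lemma runs_check_guess a11 a13 a14 b n rows go g acc X :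
  all (fun ws => size ws == n) rows ->
  0 < X -> b <= X -> n <= X -> size g <= X -> size (table_word rows) <= X ->
  runs check_guess
    (stacks [:: [::]; [::]; [::]; [::]; [::]; [::]; [::]; [::]; [::]; [::]; [::];
        a11; table_word rows; a13; a14; ones n; go; g; ones b; ones acc])
    (stacks [:: [::]; [::]; [::]; [::]; [::]; [::]; [::]; [::]; [::]; [::]; [::];
        a11; table_word rows; a13; a14; ones n; go; g; ones b;
        ones (accepts b n rows g + acc)])
    (300 * X ^ 2).
Proof.
move=> ar X0 bX nX gX MX.
set es := payments g (map row_word rows).
have ses : size rows = size es by rewrite size_payments size_map.
have drs : all (all digit) (map row_word rows).
  by rewrite all_map; apply/allP => ws _; apply: all_digit_row_word.
(* The content of register 3 at the end: the lost issues and the separators beyond the budget. *)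
set viol := count negb (won_columns n rows es) + (count_mem sep g - b).
have aE : accepts b n rows g = (viol == 0).
  by rewrite /accepts /viol addn_eq0 count_negb_eq0 andbC subn_eq0.
have violX : viol <= 2 * X.
  have := count_size negb (won_columns n rows es); rewrite won_columns_size.
  by have := count_sep_size g; rewrite /viol; lia.
have Hif : runs (If (nonempty $3) (erase $3) (push $19 one))
    (stacks [:: [::]; [::]; [::]; ones viol; [::]; [::]; [::]; [::]; [::]; [::]; [::];
        a11; table_word rows; a13; a14; ones n; go; g; ones b; ones acc])
    (stacks [:: [::]; [::]; [::]; [::]; [::]; [::]; [::]; [::]; [::]; [::]; [::];
        a11; table_word rows; a13; a14; ones n; go; g; ones b;
        ones (accepts b n rows g + acc)]) (4 * X + 3).
  rewrite aE; case: viol violX {aE} => [|v] vX.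
    by eapply runs_le; [eapply runs_ifF; [|xlast] | lia].
  by eapply runs_le; [eapply runs_ifT; [|xlast] | rewrite /= size_nseq; lia].
xrun.
  xstep. xstep. rewrite !cats0.
  eapply runs_seq; first exact: (@runs_budget_loop _ _ _ 0).
  xstep. xstep. xstep. rewrite !cats0 table_wordE.
  eapply runs_seq; first exact: (@runs_pay_voters _ _ _ _ _ _ X).
  rewrite !cats0 -table_wordE -/es.
  xstep. xstep. xstep. rewrite !revK !cats0.
  xstep. rewrite !cats0.
  eapply runs_seq; first exact: runs_column_passes.
  xstep. xstep. exact: Hif.
rewrite /= !size_nseq !size_rev.
have := size_leftover g (map row_word rows).
have := size_iter_behead n rows.
have : size (payment_word es) <= 2 * X.
  rewrite size_payment_word -ses.
  have := sumn_payments g (map row_word rows); have := count_sep_size g.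
  by have := size_rows_table rows; rewrite -/es; lia.
rewrite -table_wordE.
move: (size (payment_word es)) (size (table_word rows)) MX gX
  (size (leftover _ _)) (size (table_word (iter _ _ _))) => P M MX gX L I PX IX LX.
rewrite (_ : 300 * X ^ 2 = 300 * X * X); last by rewrite expnS expn1 mulnA.
have h1 : (16 * X + 21) * M <= 37 * (X * X) by nia.
have h2 : (30 * M + 8 * P + 12) * n <= 58 * (X * X).
  have : 30 * M + 8 * P + 12 <= 58 * X by lia.
  by move=> h; apply: leq_trans (leq_mul h nX) _; lia.
have h3 : X <= X * X by rewrite leq_pmull.
by rewrite -mulnA; lia.
Qed.

Definition ternary_digit (x : sym) : nat := if x is Some b then nat_of_bool b else 2.

(* Least significant digit first. *)
Fixpoint ternary (g : seq sym) : nat :=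
  if g is x :: g' then ternary_digit x + 3 * ternary g' else 0.

Fixpoint increment (g : seq sym) : seq sym :=
  match g with
  | [::] => [::]
  | None :: g' => zero :: increment g'
  | Some false :: g' => one :: g'
  | Some true :: g' => sep :: g'
  end.

(** After the guess that consists of [sep] only, the carry runs off the end, and popping register 16
    stops the enumeration. *)
Definition increment_guess : cmd 19 sym :=
  While (fun h => h $17 == Some sep) (Pop $17 ;; push $0 zero) ;;
  If (nonempty $17)
     (If (fun h => h $17 == Some zero) (Pop $17 ;; push $17 one) (Pop $17 ;; push $17 sep))
     (Pop $16) ;;
  move_all $0 $17.

Lemma size_increment g : size (increment g) = size g.
Proof. by elim: g => //= -[[]|] g //= ->. Qed.

Lemma ternary_lt g : ternary g < 3 ^ size g.
Proof. by elim: g => //= x g IH; rewrite expnS; case: x => [[]|] /=; lia. Qed.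

Lemma ternary_inj g g' : size g = size g' -> ternary g = ternary g' -> g = g'.
Proof.
elim: g g' => [|x g IH] [|y g'] //= [sg] E.
have xy : ternary_digit x = ternary_digit y /\ ternary g = ternary g'.
  by case: x y E => [[]|] [[]|] /=; lia.
rewrite (IH g' sg xy.2); congr cons.
by case: x y xy {E} => [[]|] [[]|] // [].
Qed.

Lemma ternary_increment g :
  ternary (increment g) = if all (pred1 sep) g then 0 else (ternary g).+1.
Proof.
elim: g => //= -[[]|] g IH /=; [lia..|].
by rewrite IH; case: ifP; lia.
Qed.

Lemma all_sep_ternary (g : seq sym) : all (pred1 sep) g -> (ternary g).+1 = 3 ^ size g.
Proof. by elim: g => //= -[[]|] g IH //= /IH; rewrite expnS; lia. Qed.

Lemma runs_increment_guess x1 x2 x3 x4 x5 x6 x7 x8 x9 x10 x11 x12 x13 x14 x15 go (g : seq sym) b acc :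
  runs increment_guess
    (stacks [:: [::]; x1; x2; x3; x4; x5; x6; x7; x8; x9; x10; x11; x12; x13; x14; x15;
        one :: go; g; b; acc])
    (stacks [:: [::]; x1; x2; x3; x4; x5; x6; x7; x8; x9; x10; x11; x12; x13; x14; x15;
        (if all (pred1 sep) g then go else one :: go); increment g; b; acc])
    (8 * size g + 8).
Proof.
have Hloop u r x0 : stops (pred1 sep) r ->
  runs (While (fun h => h $17 == Some sep) (Pop $17 ;; push $0 zero))
    (stacks [:: x0; x1; x2; x3; x4; x5; x6; x7; x8; x9; x10; x11; x12; x13; x14; x15;
        one :: go; seps u ++ r; b; acc])
    (stacks [:: nseq u zero ++ x0; x1; x2; x3; x4; x5; x6; x7; x8; x9; x10; x11; x12; x13; x14; x15;
        one :: go; r; b; acc]) (4 * u + 1).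
  move=> sr; elim: u x0 => [|u IH] x0.
    by apply: runs_whileF; case: (r) sr.
  xrun; first xloop.
  - by xstep; xlast.
  - by eapply runs_eq; [exact: IH | rewrite cat_nseq_cons].
  by lia.
have [u [r [-> sr]]] : exists u r, g = seps u ++ r /\ stops (pred1 sep) r.
  exists (find digit g), (drop (find digit g) g).
  rewrite -take_find_digit cat_take_drop; split=> //.
  by elim: (g) => //= -[x|] g3 //=.
have incE : increment (seps u ++ r) = nseq u zero ++ increment r.
  by elim: u => //= u ->.
have allE : all (pred1 sep) (seps u ++ r) = (r == [::]).
  by rewrite all_cat all_nseq orbT /=; case: r sr {incE} => //= x r /negbTE ->.
rewrite incE allE size_cat size_nseq.
xrun.
  eapply runs_seq; first exact: Hloop.
  eapply (@runs_seq _ _ _ _ _ (stacks [:: nseq u zero ++ [::]; x1; x2; x3; x4; x5; x6; x7; x8; x9; x10; x11; x12; x13; x14; x15;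
        if r == [::] then go else one :: go; increment r; b; acc]) _ 5).
    case: r sr {incE allE} => [|[[]|] r] //= _.
    - by eapply runs_le; [eapply runs_ifF; [|xlast] | ].
    - eapply runs_le; [eapply runs_ifT => //; eapply runs_ifF => //; xstep; xlast; reflexivity | by []].
    - eapply runs_le; [eapply runs_ifT => //; eapply runs_ifT => //; xstep; xlast; reflexivity | by []].
  xlast. by rewrite cats0 rev_nseq.
by rewrite /= cats0 size_nseq; lia.
Qed.

Definition enumerate : cmd 19 sym := While (nonempty $16) (check_guess ;; increment_guess).

(** An arbitrary starting guess makes induction on the number of guesses still to come possible. The
    search starts at the word of zeros, whose ternary value is 0, so it sees all words of that
    length. *)
Lemma runs_enumerate a11 a13 a14 b n rows g acc X :
  all (fun ws => size ws == n) rows ->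
  0 < X -> b <= X -> n <= X -> size g <= X -> size (table_word rows) <= X ->
  exists g' acc',
    runs enumerate
    (stacks [:: [::]; [::]; [::]; [::]; [::]; [::]; [::]; [::]; [::]; [::]; [::];
        a11; table_word rows; a13; a14; ones n; [:: one]; g; ones b; ones acc])
    (stacks [:: [::]; [::]; [::]; [::]; [::]; [::]; [::]; [::]; [::]; [::]; [::];
        a11; table_word rows; a13; a14; ones n; [::]; g'; ones b; ones acc'])
    (320 * X ^ 2 * (3 ^ size g - ternary g) + 1) /\
    (0 < acc' <-> 0 < acc \/
      exists h, [/\ size h = size g, ternary g <= ternary h & accepts b n rows h]).
Proof.
move=> ar X0 bX nX gX MX.
have [d] := ubnP (3 ^ size g - ternary g).
elim: d g acc gX => // d IH g acc gX gd.
have gl := ternary_lt g.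
have H1 := @runs_check_guess a11 a13 a14 b n rows [:: one] g acc X ar X0 bX nX gX MX.
have H2 := runs_increment_guess [::] [::] [::] [::] [::] [::] [::] [::] [::] [::] a11
  (table_word rows) a13 a14 (ones n) [::] g (ones b) (ones (accepts b n rows g + acc)).
have le1 : 8 * size g + 8 <= 16 * X ^ 2.
  have h3 : X <= X * X by rewrite leq_pmull.
  by rewrite (_ : X ^ 2 = X * X); lia.
have Q0 : 0 < X ^ 2 by rewrite expn_gt0 X0.
(* A word is determined by its length and its ternary value, so the guesses from [g] on are [g]
   itself and those from its successor on. *)
have first_step h : size h = size g -> ternary g <= ternary h ->
    h = g \/ ternary g < ternary h.
  move=> sh; rewrite leq_eqVlt => /orP[/eqP e|]; last by right.
  by left; apply: ternary_inj.
case: ifP H2 => ag H2.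
  exists (increment g), (accepts b n rows g + acc); split.
    xrun; first xloop.
    - by eapply runs_seq; [exact: H1 | exact: H2].
    - by xexit.
    have e := all_sep_ternary ag; rewrite (_ : 3 ^ size g - ternary g = 1); last by lia.
    by lia.
  rewrite addn_gt0 lt0b; split.
    case/orP => [ok|->]; [right | by left].
    by exists g.
  case=> [->|[h [sh gh ok]]]; first by rewrite orbT.
  case: (first_step h sh gh) ok => [-> -> //|].
  by have := all_sep_ternary ag; have := ternary_lt h; rewrite sh; lia.
have ti := ternary_increment g; rewrite ag in ti.
have ib := ternary_lt (increment g); rewrite ti size_increment in ib.
have [||g' [acc' [r1 r2]]] := IH (increment g) (accepts b n rows g + acc).
- by rewrite size_increment.
- by rewrite size_increment ti; lia.
exists g', acc'; split.
  xrun; first xloop.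
  - by eapply runs_seq; [exact: H1 | exact: H2].
  - exact: r1.
  rewrite size_increment ti.
  rewrite (_ : 3 ^ size g - ternary g = (3 ^ size g - (ternary g).+1).+1); last by lia.
  by rewrite mulnS; lia.
rewrite r2 addn_gt0 lt0b ti size_increment; split.
  case=> [/orP[ok|->]|[h [sh gh ok]]]; [right | by left | right].
    by exists g.
  by exists h; split=> //; apply: ltnW.
case=> [->|[h [sh gh ok]]]; first by left; rewrite orbT.
by case: (first_step h sh gh) ok => [-> -> //|gh' ok]; [left | right; exists h].
Qed.

(** * Integer division on binary numbers *)

Definition set_flag (i : reg) (p : (reg -> option sym) -> bool) : cmd 19 sym :=
  If p (If (fun h => at_one (h i)) Nop (push i one))
       (If (fun h => at_one (h i)) (Pop i) Nop).

Local Notation flag b := (ones (nat_of_bool b)).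

Lemma runs_set_flag (i : reg) p l (c : bool) :
  nth [::] l i = flag c ->
  runs (set_flag i p) (stacks l) (stacks (set_nth [::] l i (flag (p (tops (stacks l)))))) 4.
Proof.
move=> lc.
have E : c = p (tops (stacks l)) -> stacks l = stacks (set_nth [::] l i (flag (p (tops (stacks l))))).
  by move=> <-; rewrite -upd_st -lc -[nth _ _ _]/(stacks l i) upd_id.
rewrite /set_flag; case P : (p (tops (stacks l))).
  apply: runs_ifT => //; case: c lc E => lc E.
    by apply: runs_ifT; rewrite /= ?lc //; apply: runs_nop_le => //; rewrite E P.
  apply: runs_ifF; rewrite /= ?lc //.
  by eapply runs_eq; [xcmd | rewrite lc].
apply: runs_ifF; rewrite ?P //; case: c lc E => lc E.
  apply: runs_ifT; rewrite /= ?lc //; apply: (@runs_le _ _ _ _ _ 1) => //.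
  by eapply runs_eq; [xcmd | rewrite lc].
by apply: runs_ifF; rewrite /= ?lc //; apply: runs_nop_le => //; rewrite E P.
Qed.

(* One pass computes the bits of [R + num] and of [R + num - den] simultaneously,
   where registers 1, 4 and 5 hold [R], [num] and [den], least significant bit
   first, and registers 8 and 9 hold the carry and the borrow. *)
Definition add_sub_step : cmd 19 sym :=
  Push $6 (fun h => Some (at_one (h $1) (+) at_one (h $4) (+) at_one (h $8))) ;;
  Push $7 (fun h => Some (at_one (h $6) (+) at_one (h $5) (+) at_one (h $9))) ;;
  set_flag $9 (fun h => if at_one (h $6) then at_one (h $5) && at_one (h $9)
                        else at_one (h $5) || at_one (h $9)) ;;
  set_flag $8 (fun h => 1 < at_one (h $1) + at_one (h $4) + at_one (h $8)) ;;
  Pop $1 ;;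
  If (nonempty $4) (mov None $4 $2) Nop ;;
  If (nonempty $5) (mov None $5 $3) Nop.

Definition add_sub_loop : cmd 19 sym :=
  While (fun h => [|| nonempty $1 h, nonempty $4 h, nonempty $5 h | at_one (h $8)])
    add_sub_step.

Lemma at_one_head (s : seq bool) : at_one (ohead (bits s)) = head false s.
Proof. by case: s => [|[]]. Qed.

Lemma behead_bits s : behead (bits s) = bits (behead s).
Proof. by case: s. Qed.

Lemma at_one_flag (b : bool) : at_one (ohead (flag b)) = b.
Proof. by case: b. Qed.

Lemma runs_add_sub_step a0 r u d (c bo : bool) x2 x3 S D l :
  let s := head false r (+) head false u (+) c in
  let e := s (+) head false d (+) bo in
  runs add_sub_step
    (stacks [:: a0, bits r, x2, x3, bits u, bits d, S, D, flag c, flag bo & l])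
    (stacks [:: a0, bits (behead r), rev (take 1 (bits u)) ++ x2, rev (take 1 (bits d)) ++ x3,
          bits (behead u), bits (behead d), Some s :: S, Some e :: D,
          flag (1 < head false r + head false u + c),
          flag (if s then head false d && bo else head false d || bo) & l]) 21.
Proof.
move=> s e; have idE (b : bool) : (if b then true else false) = b by case: b.
xrun.
  xstep. rewrite !at_one_head at_one_flag -/s.
  xstep. rewrite !at_one_head at_one_flag.
  eapply runs_seq; first by apply: (@runs_set_flag _ _ _ bo).
  rewrite /= !at_one_head at_one_flag !idE -/e.
  eapply runs_seq; first by apply: (@runs_set_flag _ _ _ c).
  rewrite /= !at_one_head at_one_flag.
  xstep.
  eapply (@runs_seq _ _ _ _ _
      (stacks [:: a0, bits (behead r), rev (take 1 (bits u)) ++ x2, x3,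
          bits (behead u), bits d, Some s :: S, Some e :: D,
          flag (1 < head false r + head false u + c),
          flag (if s then head false d && bo else head false d || bo) & l]) _ 4).
    rewrite behead_bits; clearbody e s; case: u => [|y u].
      by eapply runs_ifF; [|apply: runs_nop_le].
    by eapply runs_ifT; [|xlast; rewrite take0].
  instantiate (1 := 4).
  clearbody e s; case: d => [|y d].
    by eapply runs_ifF; [|apply: runs_nop_le].
  by eapply runs_ifT; [|xlast; rewrite take0].
by [].
Qed.

Lemma lsb_head s : lsb s = head false s + 2 * lsb (behead s).
Proof. by case: s => //= b s. Qed.

Lemma size_behead_le (A : Type) (s : seq A) n : size s <= n.+1 -> size (behead s) <= n.
Proof. by rewrite size_behead; case: (size s). Qed.

(** As [s] and [e] have the same length, the last equation with [bo] false forces [bo'] to be set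
    exactly when [lsb s < lsb d]. The comparison thus comes for free with the sum and the
    difference. *)
Lemma runs_add_sub_loop n a0 r u d (c bo : bool) x2 x3 S D l :
  size r <= n -> size u <= n -> size d <= n ->
  exists s e (bo' : bool),
  [/\ runs add_sub_loop
    (stacks [:: a0, bits r, x2, x3, bits u, bits d, S, D, flag c, flag bo & l])
    (stacks [:: a0, [::], rev (bits u) ++ x2, rev (bits d) ++ x3, [::], [::],
          rev (bits s) ++ S, rev (bits e) ++ D, [::], flag bo' & l]) (22 * n + 23),
    size s <= n.+1, size e = size s,
    lsb s = lsb r + lsb u + c &
    lsb s + bo' * 2 ^ size s = lsb e + lsb d + bo].
Proof.
elim: n r u d c bo x2 x3 S D => [|n IH] r u d c bo x2 x3 S D.
  rewrite !leqn0 !size_eq0 => /eqP-> /eqP-> /eqP->.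
  case: c.
    (* A carry that outlives all digits produces one more digit, whence the length bound [n.+1]. *)
    exists [:: true], [:: ~~ bo], false; split=> //; last by case: bo.
    xrun; first eapply runs_whileT; first by [].
    - exact: runs_add_sub_step.
    - by case: bo; xexit.
    by [].
  exists [::], [::], bo; split=> //; last by rewrite /= muln1.
  by apply: (@runs_le _ _ _ _ _ 1) => //; xexit.
move=> sr su sd.
case: (boolP [&& r == [::], u == [::], d == [::] & ~~ c]) => [/and4P[/eqP-> /eqP-> /eqP-> cF]|ne].
  case: c cF => // _.
  exists [::], [::], bo; split=> //; last by rewrite /= muln1.
  by apply: (@runs_le _ _ _ _ _ 1) => //; xexit.
have := runs_add_sub_step a0 r u d c bo x2 x3 S D l.
set s0 := head false r (+) head false u (+) c; set e0 := s0 (+) head false d (+) bo => /= H.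
have [s [e [bo' [H' ss se Es Ee]]]] := IH _ _ _ (1 < head false r + head false u + c)
  (if s0 then head false d && bo else head false d || bo)
  (rev (take 1 (bits u)) ++ x2) (rev (take 1 (bits d)) ++ x3) (Some s0 :: S) (Some e0 :: D)
  (size_behead_le sr) (size_behead_le su) (size_behead_le sd).
have rev_step (w : seq bool) y : rev (bits (behead w)) ++ rev (take 1 (bits w)) ++ y = rev (bits w) ++ y.
  by rewrite catA -rev_cat; case: w => [|x w] /=; rewrite ?take0.
exists (s0 :: s), (e0 :: e), bo'; split.
- xrun; first eapply runs_whileT.
  + by case: (r) (u) (d) (c) ne => [|? ?] [|? ?] [|? ?] [].
  + exact: H.
  + by eapply runs_eq; [exact: H' | rewrite !rev_step !rev_cons -!cats1 -!catA].
  by clear; lia.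
- by [].
- by rewrite /= se.
- rewrite /= Es (lsb_head r) (lsb_head u) /s0; clear.
  by case: (head _ r) (head _ u) (c) => [] [] [] /=; lia.
rewrite /= expnS (lsb_head d); move: Ee; rewrite /e0.
move: (2 ^ _) (lsb s) (lsb e) (lsb (behead d)) => E x y z; clear.
by case: s0 (head _ d) (bo) (bo') => [] [] [] [] /=; lia.
Qed.

Definition divide_step : cmd 19 sym :=
  add_sub_loop ;;
  If (fun h => at_one (h $9)) (push $12 one ;; erase $7 ;; move_all $6 $1)
                              (push $11 one ;; erase $6 ;; move_all $7 $1) ;;
  erase $9 ;; move_all $2 $4 ;; move_all $3 $5 ;; Pop $10.

Lemma lsb_lt s : lsb s < 2 ^ size s.
Proof. by elim: s => //= b s IH; rewrite expnS; case: b; lia. Qed.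

(** From [lsb r < lsb d] and [lsb u <= lsb d] the sum is less than twice the divisor, so one
    subtraction suffices. Leading zeros are not removed, so the remainder may gain a digit. *)
Lemma runs_divide_step n a0 r u d k a c l :
  size r <= n -> size u <= n -> size d <= n -> lsb r < lsb d -> lsb u <= lsb d ->
  exists r',
  [/\ runs divide_step
    (stacks [:: a0, bits r, [::], [::], bits u, bits d, [::], [::], [::], [::],
            ones k.+1, ones a, ones c & l])
    (stacks [:: a0, bits r', [::], [::], bits u, bits d, [::], [::], [::], [::], ones k,
          ones ((lsb d <= lsb r + lsb u) + a),
          ones (~~ (lsb d <= lsb r + lsb u) + c) & l]) (36 * n + 50),
    size r' <= n.+1,
    lsb r' < lsb d &
    lsb r' + (lsb d <= lsb r + lsb u) * lsb d = lsb r + lsb u].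
Proof.
move=> sr su sd rd ud.
have [s [e [bo [H ss se Es Ee]]]] := @runs_add_sub_loop n a0 r u d false false
  [::] [::] [::] [::] [:: ones k.+1, ones a, ones c & l] sr su sd.
rewrite !addn0 /= in Es Ee.
have le_bo : (lsb d <= lsb r + lsb u) = ~~ bo.
  by rewrite -Es; have := lsb_lt e; rewrite se; case: bo {H} Ee => /=; lia.
rewrite le_bo negbK; exists (if bo then s else e); split.
- xrun.
    eapply runs_seq; first exact: H.
    rewrite !cats0.
    eapply (@runs_seq _ _ _ _ _ (stacks [:: a0, bits (if bo then s else e), rev (bits u),
       rev (bits d), [::], [::], [::], [::], [::], flag bo,
       ones k.+1, ones (~~ bo + a), ones (bo + c) & l]) _ (6 * n + 20)).
      case: (bo) => /=.
        eapply runs_le; first eapply runs_ifT; first by [].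
          by xstep; xstep; xlast; rewrite revK cats0.
        by rewrite /= !size_rev !size_map se; lia.
      eapply runs_le; first eapply runs_ifF; first by [].
        by xstep; xstep; xlast; rewrite revK cats0.
      by rewrite /= !size_rev !size_map se; lia.
    by xstep; xstep; xstep; xlast; rewrite !revK !cats0.
  by rewrite /= !size_rev !size_map size_nseq; case: (bo); lia.
- by case: bo {H Ee le_bo}; rewrite ?se.
- by have := lsb_lt e; rewrite se; case: bo {H} le_bo Ee; lia.
by case: bo {H} le_bo Ee => /=; lia.
Qed.

(* Repeated [k] times from the remainder 0, the step divides [k * num] by [den]
   without multiplying binary numbers. *)
Definition divide : cmd 19 sym := While (nonempty $10) divide_step.

(** The steps with a subtraction count the quotient and those without count [k - q]. For the
    threshold, the second counter is directly the number of winning values. *)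
Lemma runs_divide k n a0 r u d a c l :
  size r <= n -> size u <= n -> size d <= n -> lsb r < lsb d -> lsb u <= lsb d ->
  let q := (lsb r + k * lsb u) %/ lsb d in
  exists r',
  runs divide
    (stacks [:: a0, bits r, [::], [::], bits u, bits d, [::], [::], [::], [::],
            ones k, ones a, ones c & l])
    (stacks [:: a0, bits r', [::], [::], bits u, bits d, [::], [::], [::], [::], [::],
          ones (q + a), ones (k - q + c) & l]) ((36 * (n + k) + 51) * k + 1) /\
  size r' <= n + k.
Proof.
elim: k n r a c => [|k IH] n r a c sr su sd rd ud.
  exists r; rewrite mul0n !addn0 divn_small // muln0; split=> //.
  by xexit.
have [r1 [H sr1 rd1 E]] := runs_divide_step a0 k a c l sr su sd rd ud.
have [r2 [H2 sr2]] := IH n.+1 r1 ((lsb d <= lsb r + lsb u) + a)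
  (~~ (lsb d <= lsb r + lsb u) + c) sr1 (leqW su) (leqW sd) rd1 ud.
set q := (lsb r + k.+1 * lsb u) %/ lsb d.
set q1 := (lsb r1 + k * lsb u) %/ lsb d in H2.
have d0 : 0 < lsb d by apply: leq_trans rd.
have qE : q = (lsb d <= lsb r + lsb u) + q1.
  rewrite /q mulSn addnA; move: E; case: (_ <= _) => /= <-; last by rewrite addn0.
  by rewrite addnAC [_ + 1 * _]addnC divnMDl.
have q1k : q1 <= k by rewrite -ltnS /q1 ltn_divLR //; nia.
exists r2; split; last by rewrite addnS.
xrun; first eapply runs_whileT; first by [].
- exact: H.
- eapply runs_eq; first exact: H2.
  rewrite qE; congr (stacks [:: _, _, _, _, _, _, _, _, _, _, _, ones _, ones _ & _]).
    by rewrite addnCA addnA.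
  by case: (lsb d <= _) => /=; lia.
by nia.
Qed.

(** * The decision program *)

(** Unary division of the budget by [n]: registers 2 and 3 form a counter modulo [n], and register 4
    counts its full rounds. *)
Definition share_loop : cmd 19 sym :=
  While (nonempty $1)
    (Pop $1 ;; mov None $2 $3 ;; If (nonempty $2) Nop (push $4 one ;; move_all $3 $2)).

Lemma runs_share_loop a0 n r x q l : r < n ->
  runs share_loop (stacks [:: a0, ones x, ones (n - r), ones r, ones q & l])
    (stacks [:: a0, [::], ones (n - (r + x) %% n), ones ((r + x) %% n),
            ones ((r + x) %/ n + q) & l])
    ((4 * n + 15) * x + 1).
Proof.
elim: x r q => [|x IH] r q rn.
  by rewrite addn0 muln0 modn_small // divn_small //; xexit.
rewrite -addSnnS; have [d nE] : exists d, n = r.+1 + d by exists (n - r.+1); lia.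
have e1 : n - r = d.+1 by lia.
rewrite e1; case: d nE e1 => [|d] nE e1.
  rewrite addn0 in nE; rewrite -nE.
  have n0 : 0 < n by lia.
  have H := IH 0 q.+1 n0; rewrite subn0 add0n in H.
  xrun; first (eapply runs_whileT; [by [] | |
    by eapply runs_eq; [exact: H | rewrite modnDl divnDl ?dvdnn // divnn n0 addnS -addSn]]).
  - xstep. xstep.
    eapply runs_ifF; first by [].
    xstep; xlast; rewrite cats0 -[one :: ones r]/(ones r.+1) rev_nseq -nE.
    reflexivity.
  by rewrite /= size_nseq; lia.
have rn' : r.+1 < n by lia.
xrun; first eapply runs_whileT; first by [].
- xstep. xstep.
  by eapply runs_ifT; [|exact: runs_nop].
- eapply runs_eq.
  have := IH r.+1 q rn'; rewrite (_ : n - r.+1 = d.+1); [apply | lia].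
  by [].
by lia.
Qed.

Definition zeros_loop : cmd 19 sym :=
  While (nonempty $1)
    (Pop $1 ;; While (nonempty $2) (mov None $2 $3 ;; push $4 zero) ;; move_all $3 $2).

Lemma runs_zeros_loop a0 x y z l :
  runs zeros_loop (stacks [:: a0, ones x, ones y, [::], nseq z zero & l])
    (stacks [:: a0, [::], ones y, [::], nseq (x * y + z) zero & l])
    ((10 * y + 5) * x + 1).
Proof.
have Hin v w w' z' : runs (While (nonempty $2) (mov None $2 $3 ;; push $4 zero))
    (stacks [:: a0, ones v, ones w, ones w', nseq z' zero & l])
    (stacks [:: a0, ones v, [::], ones (w + w'), nseq (w + z') zero & l]) (6 * w + 1).
  elim: w w' z' => [|w IH] w' z'; first by xexit.
  xrun; first xloop.
  - by xstep; xlast.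
  - by eapply runs_eq; [exact: (IH w'.+1 z'.+1) | rewrite !addnS].
  by lia.
elim: x z => [|x IH] z; first by rewrite muln0; xexit.
xrun; first xloop.
- xstep.
  eapply runs_seq; first exact: (Hin x y 0).
  by xlast; rewrite addn0 rev_nseq cats0.
- by eapply runs_eq; [exact: IH | rewrite mulSn addnA [_ + y]addnC].
by rewrite /= addn0 size_nseq; lia.
Qed.

(** The numeral of 0 is the bare end marker and that of 1 has a single digit before it, so the first
    symbol decides. *)
Definition read_targets : cmd 19 sym :=
  While (nonempty $1)
    (Pop $1 ;; If (fun h => h $0 == Some sep) (push $2 zero) (Pop $0 ;; push $2 one) ;;
     Pop $0).

Lemma runs_read_targets (zs : seq bool) r x2 l :
  runs read_targets
    (stacks [:: encode_nats (map nat_of_bool zs) ++ r, ones (size zs), x2 & l])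
    (stacks [:: r, [::], rev (bits zs) ++ x2 & l]) (8 * size zs + 1).
Proof.
elim: zs x2 => [|z zs IH] x2; first by xexit.
xrun; first xloop.
- xstep.
  eapply (@runs_seq _ _ _ _ _ (stacks [:: sep :: encode_nats (map nat_of_bool zs) ++ r,
      ones (size zs), Some z :: x2 & l]) _ 4).
    case: z => /=.
      by eapply runs_le; [eapply runs_ifF; [|xstep; xlast] |].
    by eapply runs_le; [eapply runs_ifT; [|xlast] |].
  by xlast.
- by eapply runs_eq; [exact: IH | rewrite /= rev_cons -cats1 -catA].
by rewrite /=; lia.
Qed.

Definition prepare : cmd 19 sym :=
  move_all $10 $1 ;; conv ;; move_all $2 $10 ;; push $10 one ;;
  divide ;; erase $1 ;; erase $4 ;; erase $5 ;;
  move_all $11 $6 ;; push $6 one ;; move_all $12 $8 ;;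
  copy None $16 $1 $2 ;; copy None $15 $2 $3 ;; share_loop ;; erase $2 ;; erase $3 ;;
  move_all $4 $18 ;;
  copy None $16 $1 $2 ;; copy None $16 $2 $3 ;; push $2 one ;; push $2 one ;; push $2 one ;;
  zeros_loop ;; erase $2 ;; move_all $4 $17 ;;
  copy None $18 $10 $1 ;; push $10 one ;;
  rows_prog ;;
  erase $6 ;; erase $8 ;; erase $10 ;; erase $16 ;; push $16 one.

Lemma size_bits_of_nat x : size (bits_of_nat x) < size (encode_nat x).
Proof. by rewrite encode_natE size_cat /= /bits size_map addn1. Qed.

Lemma runs_prepare n k B u d zs css S :
  size zs = n -> 0 < n -> 0 < d -> u <= d ->
  let a1 := (k.+1 * u %/ d).+1 in
  let c := k.+1 - k.+1 * u %/ d in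
  all (fun cs => size zs == size cs) css ->
  all (all (fun x => size x.2 == a1 + c)) css ->
  let rows := map (capped_row a1 c (B %/ n).+1 zs) css in
  n <= S -> k < S ->
  size (bits_of_nat k) <= S -> size (bits_of_nat u) <= S -> size (bits_of_nat d) <= S ->
  size (encode_nats (flatten (map row_numbers css))) <= S ->
  runs prepare
      (stacks [:: encode_nats (flatten (map row_numbers css)); [::]; [::]; [::];
        bits (bits_of_nat u); bits (bits_of_nat d); [::]; [::]; [::]; [::];
        bits (bits_of_nat k); [::]; [::]; bits zs; [::]; ones n; ones B; [::]; [::]; [::]])
      (stacks [:: [::]; [::]; [::]; [::]; [::]; [::]; [::]; [::]; [::]; [::]; [::];
        [::]; table_word rows; bits zs; [::]; ones n; [:: one]; nseq (B * (B + 3)) zero;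
        ones (B %/ n); [::]]) (1000 * (S * (B + 4) ^ 2) ^ 2).
Proof.
move=> szs n0 d0 ud a1 c acs asz rows nS kS kb ub db cb.
have [r' [Hd sr']] := @runs_divide k.+1 S
  (encode_nats (flatten (map row_numbers css))) [::] (bits_of_nat u) (bits_of_nat d) 0 0
  [:: bits zs; [::]; ones n; ones B; [::]; [::]; [::]] isT ub db
  ltac:(by rewrite lsb_bits_of_nat) ltac:(by rewrite !lsb_bits_of_nat).
rewrite !lsb_bits_of_nat /= add0n !addn0 in Hd.
set q := k.+1 * u %/ d in Hd.
xrun.
  xstep.
  eapply runs_seq; first by rewrite cats0 -map_rev; exact: (@runs_conv _ _ 0).
  rewrite horner_rev lsb_bits_of_nat addn0.
  xstep. rewrite rev_nseq cats0.
  xstep.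
  eapply runs_seq; first exact: Hd.
  xstep. xstep. xstep. xstep. rewrite rev_nseq cats0.
  xstep. xstep. rewrite rev_nseq cats0.
  xstep. xstep. rewrite !cats0.
  eapply runs_seq.
    have := @runs_share_loop (encode_nats (flatten (map row_numbers css))) n 0 B 0.
    by rewrite subn0 add0n; apply.
  rewrite addn0.
  xstep. xstep. xstep. rewrite rev_nseq cats0.
  xstep. rewrite !cats0.
  xstep. rewrite !cats0.
  xstep. xstep. xstep.
  eapply runs_seq; first exact: (@runs_zeros_loop _ B B.+3 0).
  xstep. xstep. rewrite addn0 rev_nseq cats0.
  xstep. rewrite cats0.
  xstep.
  eapply runs_seq.
    apply: (@runs_rows css zs a1 c (B %/ n).+1) => //.
    by rewrite szs.
  xstep. xstep. xstep. xstep. xlast.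
  by rewrite -/rows addn3.
rewrite /= !(size_map, size_rev, size_nseq).
have qk : q <= k.+1 by rewrite /q -[leqRHS](mulnK _ d0) leq_div2r // leq_mul2l ud orbT.
have bB : B %/ n <= B by apply: leq_div.
have mB : B %% n <= n by apply: ltnW; rewrite ltn_mod.
rewrite horner_rev lsb_bits_of_nat mul0n addn0 /c /a1 -/q.
clear Hd; have S0 : 0 < S by apply: leq_trans nS.
set X := S * (B + 4) ^ 2.
have SX : S * (B + 4) <= X by rewrite /X expnS expn1 mulnA leq_pmulr // addn4.
have QX : (B + 4) * (B + 4) <= X by rewrite /X expnS expn1 leq_pmull.
have SB : S + B <= S * (B + 4) by nia.
have h1 : (14 * k + 13) * size (bits_of_nat k) <= 27 * S ^ 2.
  by rewrite expnS expn1 mulnA; apply: leq_mul => //; lia.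
have h2 : (36 * (S + k.+1) + 51) * k.+1 <= 123 * S ^ 2.
  by rewrite expnS expn1 mulnA; apply: leq_mul => //; lia.
have h3 : (4 * n + 15) * B <= 19 * (S * (B + 4)).
  by rewrite mulnA; apply: leq_mul; lia.
have h4 : (10 * B.+3 + 5) * B <= 10 * ((B + 4) * (B + 4)).
  by rewrite mulnA; apply: leq_mul; lia.
have h5 : (45 * (B %/ n).+1 + 80) * size (encode_nats (flatten (map row_numbers css)))
    <= 80 * (S * (B + 4)).
  have h : 45 * (B %/ n).+1 + 80 <= 80 * (B + 4) by lia.
  by apply: leq_trans (leq_mul h cb) _; rewrite -mulnA [_ * S]mulnC.
have h6 : B * B.+3 <= (B + 4) * (B + 4) by apply: leq_mul; lia.
have X1 : S ^ 2 <= X ^ 2 by rewrite leq_exp2r //; lia.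
have X2 : X <= X ^ 2 by rewrite -[leqLHS]expn1 leq_pexp2l //; lia.
clear -SX QX SB h1 h2 h3 h4 h5 h6 X1 X2 sr' qk bB mB nS kS kb ub db S0.
(* With the products abstracted, the remaining inequality is linear. *)
move: (B * B.+3) (S ^ 2) (X ^ 2) ((B + 4) * (B + 4)) (S * (B + 4)) (size r') (B %/ n) (B %% n)
  (_ * size (encode_nats _)) ((10 * B.+3 + 5) * B) ((4 * n + 15) * B)
  ((36 * (S + k.+1) + 51) * k.+1) ((14 * k + 13) * size (bits_of_nat k))
  SX QX SB h1 h2 h3 h4 h5 h6 X1 X2 sr' bB mB => *.
lia.
Qed.

Definition read_header : cmd 19 sym :=
  read_number ;; conv ;; move_all $2 $15 ;;
  read_number ;; move_all $1 $10 ;;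
  read_number ;; conv ;; move_all $2 $16 ;;
  read_number ;; move_all $1 $4 ;;
  read_number ;; move_all $1 $5 ;;
  copy None $15 $1 $2 ;; read_targets ;; move_all $2 $13.

Lemma rev_bits_rev s : rev (bits (rev s)) = bits s.
Proof. by rewrite /bits map_rev revK. Qed.

Lemma runs_read_header n k B u d zs rest S : size zs = n ->
  size (encode_nats ([:: n; k; B; u; d] ++ map nat_of_bool zs)) <= S ->
  runs read_header
    (stacks [:: encode_nats ([:: n; k; B; u; d] ++ map nat_of_bool zs) ++ rest; [::]; [::]; [::];
      [::]; [::]; [::]; [::]; [::]; [::]; [::]; [::]; [::]; [::]; [::]; [::]; [::]; [::]; [::];
      [::]])
    (stacks [:: rest; [::]; [::]; [::];
      bits (bits_of_nat u); bits (bits_of_nat d); [::]; [::]; [::]; [::];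
      bits (bits_of_nat k); [::]; [::]; bits zs; [::]; ones n; ones B; [::]; [::]; [::]])
    (200 * (S * (B + 4) ^ 2) ^ 2).
Proof.
move=> szs sS; subst n.
have nS : size zs <= S.
  apply: leq_trans sS; apply: leq_trans (size_encode_nats _).
  by rewrite size_cat size_map leq_addl.
have sizes : [/\ size (encode_nat (size zs)) <= S, size (encode_nat k) <= S, size (encode_nat B) <= S,
     size (encode_nat u) <= S & size (encode_nat d) <= S].
  move: sS; rewrite encode_nats_cat size_cat !encode_nats_cons !size_cat.
  by split; lia.
case: sizes => en ek eB eu ed.
rewrite encode_nats_cat !encode_nats_cons -!catA /=.
xrun.
  eapply runs_seq; first exact: runs_read_number.
  eapply runs_seq; first exact: (@runs_conv _ _ 0).
  rewrite horner_rev lsb_bits_of_nat mul0n addn0.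
  xstep. rewrite rev_nseq cats0.
  eapply runs_seq; first exact: runs_read_number.
  xstep. rewrite cats0 rev_bits_rev.
  eapply runs_seq; first exact: runs_read_number.
  eapply runs_seq; first exact: (@runs_conv _ _ 0).
  rewrite horner_rev lsb_bits_of_nat mul0n addn0.
  xstep. rewrite rev_nseq cats0.
  eapply runs_seq; first exact: runs_read_number.
  xstep. rewrite cats0 rev_bits_rev.
  eapply runs_seq; first exact: runs_read_number.
  xstep. rewrite cats0 rev_bits_rev.
  xstep. rewrite cats0.
  eapply runs_seq; first exact: runs_read_targets.
  by xlast; rewrite !cats0 revK.
rewrite /= !(size_map, size_rev, size_nseq, size_cat) /= addn0.
rewrite !horner_rev !lsb_bits_of_nat !mul0n !addn0.
have bn := leq_trans (ltnW (size_bits_of_nat (size zs))) en.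
have bk := leq_trans (ltnW (size_bits_of_nat k)) ek.
have bB := leq_trans (ltnW (size_bits_of_nat B)) eB.
have bu := leq_trans (ltnW (size_bits_of_nat u)) eu.
have bd := leq_trans (ltnW (size_bits_of_nat d)) ed.
have S0 : 0 < S by apply: leq_trans en; apply: size_encode_nat.
set X := S * (B + 4) ^ 2.
have SX : S * (B + 4) <= X by rewrite /X expnS expn1 mulnA leq_pmulr // addn4.
have SB : S + B <= S * (B + 4) by nia.
have h1 : (14 * size zs + 13) * size (bits_of_nat (size zs)) <= 27 * S ^ 2.
  by rewrite expnS expn1 mulnA; apply: leq_mul => //; lia.
have h2 : (14 * B + 13) * size (bits_of_nat B) <= 14 * (S * (B + 4)).
  have h : 14 * B + 13 <= 14 * (B + 4) by lia.
  by apply: leq_trans (leq_mul h bB) _; rewrite -mulnA [_ * S]mulnC.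
have X1 : S ^ 2 <= X ^ 2 by rewrite leq_exp2r //; lia.
have X2 : X <= X ^ 2 by rewrite -[leqLHS]expn1 leq_pexp2l //; lia.
move: X (S ^ 2) (S * (B + 4)) ((14 * B + 13) * _) ((14 * size zs + 13) * _) SX SB h1 h2 X1 X2
  => X *.
lia.
Qed.

(** Two degenerate cases are separated. Without issues the answer is yes, and B cannot be divided by
    n. Without voters nothing follows the header; the answer is no, and [k] must not be converted to
    unary, since no list of prices bounds it by the input length. *)
Definition program : cmd 19 sym :=
  skip_number ;;
  If (fun h => h $0 == Some sep) (push $19 one)
    (read_header ;; If (nonempty $0) (prepare ;; enumerate) Nop).

Lemma input_store_st (w : seq sym) :
  input_store w = stacks [:: w; [::]; [::]; [::]; [::]; [::]; [::]; [::]; [::]; [::]; [::];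
      [::]; [::]; [::]; [::]; [::]; [::]; [::]; [::]; [::]].
Proof.
apply: functional_extensionality => -[i ltiK]; rewrite /input_store /stacks -val_eqE /=.
by do 20 (case: i ltiK => // i ltiK).
Qed.

(** Justifies testing for n = 0 by looking for an immediate end marker. *)
Lemma encode_nat_digit x w : 0 < x -> ohead (encode_nat x ++ w) != Some sep.
Proof.
have := lsb_bits_of_nat x; rewrite encode_natE.
by case: (bits_of_nat x) => //= <-.
Qed.

Lemma runs_program m n k B u d zs css :
  let w := encode_nats ([:: m; n; k; B; u; d] ++ map nat_of_bool zs ++
                        flatten (map row_numbers css)) in
  let a1 := (k.+1 * u %/ d).+1 in
  let c := k.+1 - k.+1 * u %/ d in
  let rows := map (capped_row a1 c (B %/ n).+1 zs) css in
  size zs = n -> 0 < d -> u <= d ->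
  all (fun cs => n == size cs) css ->
  all (all (fun x => size x.2 == k.+2)) css ->
  exists acc s', [/\ s' $19 = ones acc,
    runs program (input_store w) s'
      (2000 * (size w * (B + 4) ^ 2) ^ 2 * 3 ^ (B * (B + 3))) &
    0 < acc <-> n = 0 \/ css <> [::] /\
      exists g, size g = B * (B + 3) /\ accepts (B %/ n) n rows g].
Proof.
move=> w a1 c rows szs d0 ud acs asz.
set S := size w; set X := S * (B + 4) ^ 2.
have S6 : 6 <= S by apply: leq_trans (size_encode_nats _); rewrite /= !ltnS leq0n.
have X0 : 0 < X by rewrite muln_gt0 expn_gt0 addn4; lia.
have SX : S <= X by rewrite leq_pmulr // expn_gt0 addn4.
have X2 : X <= X ^ 2 by rewrite -[leqLHS]expn1 leq_pexp2l.
set T3 := 3 ^ (B * (B + 3)).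
have T30 : 0 < T3 by rewrite expn_gt0.
have X2T : X ^ 2 <= X ^ 2 * T3 by rewrite leq_pmulr.
have sm : size (encode_nat m) <= S by rewrite /S /w encode_nats_cons size_cat leq_addr.
have [n0|n0] := posnP n.
  exists 1, (stacks [:: encode_nats ([:: n; k; B; u; d] ++ map nat_of_bool zs ++
                        flatten (map row_numbers css)); [::]; [::]; [::]; [::]; [::]; [::]; [::]; [::]; [::]; [::];
      [::]; [::]; [::]; [::]; [::]; [::]; [::]; [::]; [:: one]]).
  split=> //; last by split=> // _; left.
  eapply runs_le; last first.
    apply: leq_trans (_ : 2000 * X ^ 2 <= _); last by rewrite -mulnA leq_mul2l X2T orbT.
    instantiate (1 := 2 * S + 3); lia.
  rewrite input_store_st; xrun.
    eapply runs_seq.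
      rewrite /w [encode_nats ([:: m, n & _] ++ _)]encode_nats_cons; exact: runs_skip_number.
    eapply runs_ifT; first by rewrite n0.
    by xlast.
  by lia.
have wE : w = encode_nat m ++ encode_nats ([:: n; k; B; u; d] ++ map nat_of_bool zs) ++
    encode_nats (flatten (map row_numbers css)).
  by rewrite -encode_nats_cat -catA.
have hS : size (encode_nats ([:: n; k; B; u; d] ++ map nat_of_bool zs)) <= S.
  by rewrite /S wE !size_cat; lia.
have cS : size (encode_nats (flatten (map row_numbers css))) <= S.
  by rewrite /S wE !size_cat; lia.
have Hh := runs_read_header (encode_nats (flatten (map row_numbers css))) szs hS.
have hd : ohead (encode_nats ([:: n; k; B; u; d] ++ map nat_of_bool zs) ++
    encode_nats (flatten (map row_numbers css))) != Some sep.
  by rewrite encode_nats_cons -catA encode_nat_digit.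
case: css acs asz @w @rows @S wE hS cS Hh hd @X X0 SX X2 X2T S6 sm => [|cs css] acs asz w rows S
  wE hS cS Hh hd X X0 SX X2 X2T S6 sm.
  exists 0; eexists; split; last by split=> // -[n00|[] //]; rewrite n00 in n0.
    2: {
  rewrite input_store_st wE; xrun.
    eapply runs_seq; first exact: runs_skip_number.
    eapply runs_ifF; first exact: hd.
    eapply runs_seq; first exact: Hh.
    by eapply runs_ifF; [| exact: runs_nop].
  apply: leq_trans (_ : 2000 * X ^ 2 <= _); last by rewrite -mulnA leq_mul2l X2T orbT.
  by rewrite -/X; lia. }
  by [].
have [nS uS dS kbS] : [/\ n <= S, size (bits_of_nat u) <= S, size (bits_of_nat d) <= S &
    size (bits_of_nat k) <= S].
  have := size_bits_of_nat u; have := size_bits_of_nat d; have := size_bits_of_nat k.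
  have := size_encode_nats (map nat_of_bool zs); rewrite size_map szs.
  move: hS; rewrite encode_nats_cat size_cat !encode_nats_cons !size_cat.
  by split; lia.
(* There is a cell, and each of its k + 2 prices takes at least one symbol. *)
have kS : k < S.
  apply: leq_trans cS; apply: leq_trans (size_encode_nats _).
  move: acs asz => /= /andP[/eqP ncs _] /andP[acs _].
  case: cs ncs acs {rows S wE hS Hh hd X X0 SX X2 X2T S6 sm nS uS dS kbS w} n0 => [|x cs] ncs; first by rewrite ncs.
  by move=> /= /andP[/eqP sx _] _; rewrite size_cat /= size_cat sx; lia.
have q1 : k.+1 * u %/ d <= k.+1 by rewrite -[leqRHS](mulnK _ d0) leq_div2r // leq_mul2l ud orbT.
have ac : a1 + c = k.+2 by rewrite /a1 /c; lia.
have Hp := @runs_prepare n k B u d zs (cs :: css) S szs n0 d0 ud.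
cbv zeta in Hp; rewrite -/a1 -/c ac szs in Hp.
have {}Hp := Hp acs asz nS kS kbS uS dS cS.
have rn : all (fun ws => size ws == n) rows.
  rewrite all_map; apply/allP => r rcs; rewrite /= size_capped_row szs //.
  exact/eqP/(allP acs).
(* A row takes at most (b + 2) n + 1 symbols for b = floor(B / n), and n times the number of rows is
   at most the input length. *)
have tS : size (table_word rows) <= X.
  have cr : all (all (leq^~ (B %/ n).+1)) rows.
    by rewrite all_map; apply/allP => r _; apply: capped_row_le.
  apply: leq_trans (size_table_word cr rn) _; rewrite size_map.
  have := leq_trans (leq_trans (size_rows_numbers acs) (size_encode_nats _)) cS.
  have := leq_div B n.
  move: (B %/ n) (size (cs :: css)) => b p bB nm.
  apply: (@leq_trans ((B + 4) * (n * p))).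
    rewrite mulnA leq_mul2r; apply/orP; right.
    by apply: leq_trans (_ : b.+3 * n <= _); [rewrite [leqRHS]mulSn; lia | rewrite leq_mul2r; lia].
  rewrite /X expnS expn1 [leqRHS]mulnCA leq_mul //.
  by apply: leq_trans nm _; rewrite leq_pmulr // addn4.
have BX : B * (B + 3) <= X.
  rewrite /X; apply: (@leq_trans ((B + 4) ^ 2)); last by rewrite leq_pmull //; lia.
  by rewrite expnS expn1 leq_mul //; lia.
have BnX : B %/ n <= X.
  by apply: leq_trans (leq_div _ _) _; apply: leq_trans BX; rewrite leq_pmulr // addn3.
have := @runs_enumerate [::] (bits zs) [::] (B %/ n) n rows
   (nseq (B * (B + 3)) zero) 0 X rn X0 BnX (leq_trans nS SX).
rewrite size_nseq => /(_ BX tS) [g' [acc [He accE]]].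
have t0 N : ternary (nseq N zero) = 0 by elim: N => //= N ->.
rewrite t0 subn0 -/T3 in He.
have ne0 : 0 < size (encode_nats (flatten (map row_numbers (cs :: css)))).
  have := leq_trans (size_rows_numbers acs) (size_encode_nats _).
  by apply: leq_trans; rewrite muln_gt0 n0.
exists acc; eexists; split.
    2: {
  rewrite input_store_st wE; xrun.
    eapply runs_seq; first exact: runs_skip_number.
    eapply runs_ifF; first exact: hd.
    eapply runs_seq; first exact: Hh.
    eapply runs_ifT.
      by move: ne0; rewrite /=; case: (encode_nats _).
    eapply runs_seq; first exact: Hp.
    exact: He.
  rewrite -/X; move: (X ^ 2) X2 X2T SX sm => Q X2 X2T SX sm.
  by nia. }
  by [].
rewrite accE t0; split.
  by case=> // -[h [sh _ ok]]; right; split => //; exists h.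
by case=> [n00|[_ [h [sh ok]]]]; [rewrite n00 in n0 | right; exists h].
Qed.

(** * Guesses and payments *)

Lemma favorable_perm rows rows' es es' :
  perm_eq (zip rows es) (zip rows' es') -> size rows = size rows' ->
  majority rows es = majority rows' es'.
Proof.
move=> pe sr; rewrite /majority sr /favorable !count_map.
by rewrite (permP pe).
Qed.

Lemma zip_behead (rows : seq (seq nat)) (es : seq nat) :
  zip (map behead rows) es = [seq (behead we.1, we.2) | we <- zip rows es].
Proof. by elim: rows es => [|ws rows IH] [|e es] //=; rewrite IH. Qed.

(** This is the interchangeability of voters: the counts see only the multiset of pairs of row and
    payment. *)
Lemma won_columns_perm n rows es es' :
  perm_eq (zip rows es) (zip rows es') -> won_columns n rows es = won_columns n rows es'.
Proof.
elim: n rows => //= n IH rows pe; rewrite (favorable_perm pe) //.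
by rewrite IH // !zip_behead perm_map.
Qed.

Lemma prefix_ones w w' r r' :
  prefix (ones w ++ zero :: r) (ones w' ++ zero :: r') -> w = w' /\ prefix r r'.
Proof.
by elim: w w' => [|w IH] [|w'] //= /IH[-> ->].
Qed.

Lemma prefix_row_word ws ws' g : size ws = size ws' ->
  prefix (row_word ws) (row_word ws' ++ g) -> ws = ws'.
Proof.
elim: ws ws' => [|w ws IH] [|w' ws'] //= [sw].
by rewrite !row_word_cons -catA => /prefix_ones[-> /(IH _ sw) ->].
Qed.

Fixpoint guess (rows : seq (seq nat)) (es : seq nat) : seq sym :=
  match rows, es with
  | ws :: rows', e :: es' =>
      (if e is 0 then [::] else seps e ++ row_word ws) ++ guess rows' es'
  | _, _ => [::]
  end.

(** Isolates the first slot. By the last equation, removing it amounts to cancelling the payment of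
    its intended voter, which is the effect of another voter claiming it. *)
Lemma guess_split rows es : size rows = size es -> 
  guess rows es = [::] /\ es = nseq (size es) 0 \/
  exists R1 ws R2 e es2, [/\ rows = R1 ++ ws :: R2, es = nseq (size R1) 0 ++ e.+1 :: es2,
    size R2 = size es2, guess rows es = seps e.+1 ++ row_word ws ++ guess R2 es2 &
    guess rows (nseq (size R1) 0 ++ 0 :: es2) = guess R2 es2].
Proof.
elim: rows es => [|ws rows IH] [|e es] //=; first by left.
move=> [sz]; case: e => [|e]; last first.
  by right; exists [::], ws, rows, e, es; rewrite /= -catA.
case: (IH es sz) => [[E1 E2]|[R1 [ws' [R2 [e [es2 [-> -> s2 -> E]]]]]]].
  by left; rewrite E1 {1}E2.
by right; exists (ws :: R1), ws', R2, e, es2; rewrite /= E.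
Qed.

(** The padding of a guess pays nobody, although a row of zeros may claim a piece of it. *)
Lemma payments_zeros z rs : payments (nseq z zero) rs = nseq (size rs) 0.
Proof.
elim: rs z => //= r rs IH z.
have -> : find digit (nseq z zero) = 0 by case: z.
by rewrite drop0 drop_nseq !IH; case: ifP.
Qed.

Lemma find_digit_seps e g : (if g is x :: _ then digit x else true) ->
  find digit (seps e ++ g) = e.
Proof. by move=> hg; elim: e => //= [|e ->] //; case: g hg => //= x g ->. Qed.

Lemma row_word_digit ws g : 0 < size ws ->
  if row_word ws ++ g is x :: _ then digit x else true.
Proof. by case: ws => //= -[|w] ws. Qed.

(** The delicate case is a voter with intended payment 0 whose row equals that of the first slot and
    who therefore claims it. The induction hypothesis is applied to the payments in which the
    intended voter gets 0 instead. *)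
Lemma payments_guess n rows es z : 0 < n -> all (fun ws => size ws == n) rows ->
  size rows = size es ->
  perm_eq (zip rows (payments (guess rows es ++ nseq z zero) (map row_word rows)))
          (zip rows es).
Proof.
move=> n0; elim: rows es => [|r rows IH] [|e es] //= /andP[/eqP sr ar] [sz].
case: e => [|e] /=; last first.
  rewrite -!cat_cons -[sep :: seps e]/(seps e.+1) -!catA find_digit_seps; last first.
    by rewrite row_word_digit ?sr.
  rewrite drop_size_cat ?size_nseq // prefix_prefix drop_size_cat //=.
  by rewrite perm_cons IH.
have [[-> ->]|[R1 [ws [R2 [e [es2 [E1 E2 s2 E3 E4]]]]]]] := guess_split sz.
  rewrite payments_zeros.
  have -> : find digit (nseq z zero) = 0 by case: (z).
  by rewrite drop0 drop_nseq !payments_zeros if_same size_map sz.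
have sws : size ws = n by apply/eqP/(allP ar); rewrite E1 mem_cat inE eqxx orbT.
have E5 : seps e.+1 ++ row_word ws ++ guess R2 es2 ++ nseq z zero = guess rows es ++ nseq z zero.
  by rewrite E3 -!catA.
rewrite -E5 find_digit_seps; last by rewrite row_word_digit ?sws.
rewrite [drop e.+1 _]drop_size_cat ?size_nseq //.
case: ifP => [/prefix_row_word|] pr; last by rewrite E5 /= perm_cons IH.
rewrite -pr ?sr // in E1 E3 E4 *; rewrite drop_size_cat //= -E4.
have sz' : size rows = size (nseq (size R1) 0 ++ 0 :: es2).
  by rewrite E1 !size_cat /= size_nseq s2.
(* Now [r] receives [e.+1] and the intended voter, who has the same row, receives 0; exchanging the
   two amounts does not change the multiset. *)
have := IH _ ar sz'; rewrite -(perm_cons (r, e.+1)) => /perm_trans; apply.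
rewrite E2 E1 !zip_cat ?size_nseq //=.
by apply/permP => a; rewrite /= !count_cat /=; lia.
Qed.

(** Only voters with e > 0 have a slot, so the cost of its row word can be charged to e. *)
Lemma size_guess rows es cap n : 0 < n -> all (fun ws => size ws == n) rows ->
  all (all (leq^~ cap)) rows ->
  size (guess rows es) <= sumn es * (1 + n * cap.+1).
Proof.
move=> n0; elim: rows es => [|ws rows IH] [|[|e] es] //=.
  by move=> /andP[_ ar] /andP[_ cr]; apply: IH.
move=> /andP[/eqP sw ar] /andP[cw cr].
rewrite !size_cat size_nseq; have := size_row_word cw; have := IH es ar cr; rewrite sw.
by move: (size (guess _ _)) (size (row_word _)) => x y; nia.
Qed.

Lemma exists_guess n B rows : 0 < n -> all (fun ws => size ws == n) rows ->
  all (all (leq^~ (B %/ n).+1)) rows ->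
  (exists g, size g = B * (B + 3) /\ accepts (B %/ n) n rows g) <->
  (exists es, [/\ size es = size rows, sumn es <= B %/ n & all id (won_columns n rows es)]).
Proof.
move=> n0 ar cr; split=> [[g [sg /andP[cg wg]]]|[es [sz ses wes]]].
  exists (payments g (map row_word rows)); split=> //.
    by rewrite size_payments size_map.
  exact: leq_trans (sumn_payments _ _) cg.
have sg : size (guess rows es) <= B * (B + 3).
  apply: leq_trans (size_guess _ n0 ar cr) _.
  apply: leq_trans (leq_mul ses (leqnn _)) _.
  have := leq_trunc_div B n; have := leq_div B n; move: (B %/ n) => b bB bn.
  rewrite mulnDr muln1 mulnA; apply: leq_trans (leq_add bB (leq_mul bn (_ : b.+2 <= B + 2))) _.
    by lia.
  by rewrite -{1}[B]muln1 -mulnDr leq_mul2l; lia.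
exists (guess rows es ++ nseq (B * (B + 3) - size (guess rows es)) zero); split.
  by rewrite size_cat size_nseq subnKC.
have pe := payments_guess (B * (B + 3) - size (guess rows es)) n0 ar (esym sz).
rewrite /accepts (won_columns_perm n pe) wes andbT.
rewrite count_cat count_nseq /= mul0n addn0; apply: leq_trans ses.
elim: (rows) (es) => [|ws rows' IH] [|[|e] es'] //=.
rewrite !count_cat count_nseq /= mul1n.
have -> : count_mem sep (row_word ws) = 0.
  by elim: (ws) => // w ws' IHw; rewrite row_word_cons count_cat count_nseq /= IHw.
by have := IH es'; lia.
Qed.

(** * Payments and voter briberies *)

Section Instance.

Import Order.TTheory GRing.Theory Num.Theory.
Local Open Scope ring_scope.

Variable L : lobbying_instance.

Local Notation m := (voters L).
Local Notation n := (issues L).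
Local Notation k := (level L).

Implicit Types (i : 'I_m) (j : 'I_n) (a : 'I_k.+2).

Definition winning_value j a : bool :=
  threshold L < (if target j then admissible a else 1 - admissible a).

Lemma prob_admissible i j : exists a, admissible a = prob L i j.
Proof.
have /andP[p0 p1] := prob_unit i j.
have /dvdzP[q kE] := prob_level i j.
have dE : (denq (prob L i j))%:~R != 0 :> rat by rewrite intr_eq0 denq_neq0.
have pE : prob L i j * k.+1%:R = (numq (prob L i j) * q)%:~R.
  rewrite -[k.+1%:R]/((k.+1%:Z)%:~R : rat) kE !intrM [q%:~R * _]mulrC mulrA.
  by rewrite -{1}[prob L i j]divq_num_den divfK.
have k0 : 0 < k.+1%:R :> rat by rewrite ltr0n.
have N0 : 0 <= numq (prob L i j) * q.
  by rewrite -(ler0z rat) -pE mulr_ge0 // ltW.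
have [x xE] : exists x : nat, numq (prob L i j) * q = x%:Z.
  by exists (absz (numq (prob L i j) * q)); rewrite gez0_abs.
rewrite xE in pE.
have xk : (x < k.+2)%N.
  rewrite ltnS -(ler_nat rat) -[x%:R]/((x%:Z)%:~R : rat) -pE.
  by rewrite ler_piMl // ltW.
exists (Ordinal xk); apply: (mulIf (lt0r_neq0 k0)).
by rewrite /admissible /= divfK ?lt0r_neq0 // pE.
Qed.

Lemma favors_bribed (d : 'I_m -> rat) i j (e : nat) :
  (forall a, affordable d i j a = (price i j a <= e)%N) ->
  favors (bribed_prob d) i j = [exists a, winning_value j a && (price i j a <= e)%N].
Proof.
move=> dE; rewrite /favors /bribed_prob /winning_value.
have [a0 a0E] := prob_admissible i j.
have p0 : (price i j a0 <= e)%N by rewrite price_prob.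
case: (target j); apply/idP/idP => [|/existsP[a /andP[ta pa]]].
- apply: contraTT; rewrite negb_exists => /forallP no_a; rewrite -leNgt; apply/bigmax_leP; split=> [|a].
    (* The default of the maximum is the admissible value [a0], whose price is 0. *)
    by have := no_a a0; rewrite p0 andbT -leNgt -a0E.
  by rewrite dE => /andP[_ pa]; have := no_a a; rewrite pa andbT -leNgt.
- case: (leP (prob L i j) (admissible a)) => pa'.
    by apply: lt_le_trans ta _; apply: le_bigmax_cond; rewrite pa' dE.
  by apply: lt_le_trans (lt_trans ta pa') _; apply: bigmax_ge_id.
- apply: contraTT; rewrite negb_exists => /forallP no_a; rewrite -leNgt lerBlDr -lerBlDl; apply/bigmin_geP; split=> [|a].
    by have := no_a a0; rewrite p0 andbT -leNgt -a0E; lra.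
  by rewrite dE => /andP[_ pa]; have := no_a a; rewrite pa andbT -leNgt; lra.
set M := \big[_/_]_(_ | _) _.
case: (leP (admissible a) (prob L i j)) => pa'.
  have : M <= admissible a by apply: bigmin_le_cond; rewrite pa' dE.
  by lra.
have : M <= prob L i j by apply: bigmin_le_id.
by lra.
Qed.

Local Open Scope nat_scope.

Definition threshold_num := `|numq (threshold L)|.
Definition threshold_den := `|denq (threshold L)|.
(** The largest index whose admissible value does not exceed the threshold ([threshold_lt]). *)
Definition misses := k.+1 * threshold_num %/ threshold_den.

Lemma threshold_den_gt0 : 0 < threshold_den.
Proof. by rewrite absz_gt0 denq_neq0. Qed.

Lemma thresholdE : threshold L = (threshold_num%:R / threshold_den%:R)%R :> rat.
Proof.
have /andP[t0 _] := threshold_unit L.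
rewrite /threshold_num /threshold_den -[LHS]divq_num_den.
rewrite -[in LHS](gez0_abs (ltW (denq_gt0 _))) -[in LHS](gez0_abs (_ : (0 <= numq _)%R)) //.
by rewrite numq_ge0.
Qed.

Lemma threshold_num_le_den : threshold_num <= threshold_den.
Proof.
have /andP[_] := threshold_unit L; rewrite thresholdE.
by rewrite ler_pdivrMr ?ltr0n ?threshold_den_gt0 // mul1r ler_nat.
Qed.

Lemma threshold_lt (x : nat) : (threshold L < x%:R / k.+1%:R)%R = (misses < x).
Proof.
rewrite thresholdE ltr_pdivrMr ?ltr0n ?threshold_den_gt0 // mulrAC ltr_pdivlMr ?ltr0n //.
by rewrite -!natrM ltr_nat /misses ltn_divLR ?threshold_den_gt0 // mulnC.
Qed.

Lemma winning_valueE j a :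
  winning_value j a = if target j then misses < a else a < k.+1 - misses.
Proof.
rewrite /winning_value; case: target; first exact: threshold_lt.
have ak : (a <= k.+1)%N by rewrite -ltnS.
have -> : (1 - admissible a = (k.+1 - a)%:R / k.+1%:R)%R.
  by rewrite natrB // mulrBl divff ?pnatr_eq0.
by rewrite threshold_lt; lia.
Qed.

Definition cells : seq (seq (nat * nat * seq nat)) :=
  [seq [seq (`|numq (prob L i j)|, `|denq (prob L i j)|, [seq price i j a | a <- enum 'I_k.+2])
       | j <- enum 'I_n] | i <- enum 'I_m].

Definition targets : seq bool := [seq target j | j <- enum 'I_n].

Lemma encode_lobbyingE : encode_lobbying L =
  encode_nats ([:: m; n; k; budget L; threshold_num; threshold_den] ++
    map nat_of_bool targets ++ flatten (map row_numbers cells)).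
Proof.
rewrite /encode_lobbying /lobbying_numbers; congr encode_nats.
have -> : map nat_of_bool targets = [seq nat_of_bool (target j) | j <- enum 'I_n].
  by rewrite /targets -map_comp.
do 6 congr cons; congr cat; rewrite /cells.
elim: (enum 'I_m) => //= i s <-; rewrite flatten_cat /row_numbers -map_comp.
by congr (_ ++ _); congr flatten; apply: eq_map.
Qed.

Definition needed i j : nat :=
  capped_price misses.+1 (k.+1 - misses) (budget L %/ n).+1 (target j)
    [seq price i j a | a <- enum 'I_k.+2].

Definition needed_rows : seq (seq nat) := [seq [seq needed i j | j <- enum 'I_n] | i <- enum 'I_m].

Lemma needed_rowsE :
  map (capped_row misses.+1 (k.+1 - misses) (budget L %/ n).+1 targets) cells = needed_rows.
Proof.
rewrite /needed_rows /cells -map_comp; apply: eq_map => i /=.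
rewrite /capped_row /targets; elim: (enum 'I_n) => //= j s IH.
by congr cons.
Qed.

Lemma foldl_minn_le_has cap e xs : e < cap ->
  (foldl minn cap xs <= e) = has (leq^~ e) xs.
Proof.
elim: xs cap => [|x xs IH] cap ec /=; first by rewrite leqNgt ec.
case: (leqP x e) => xe.
  apply: leq_trans xe; apply: leq_trans (foldl_minn_le _ _) _; exact: geq_minr.
by rewrite IH // leq_min ec.
Qed.

(** The hypothesis keeps [e] strictly below the cap, so an entry equal to the cap is never taken for
    an affordable one. *)
Lemma needed_le i j e : e <= budget L %/ n ->
  (needed i j <= e) = [exists a, winning_value j a && (price i j a <= e)].
Proof.
move=> eb; rewrite /needed /capped_price foldl_minn_le_has //.
have nthE (x : 'I_k.+2) : nth 0 [seq price i j a | a <- enum 'I_k.+2] x = price i j x.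
  by rewrite (nth_map x) ?size_enum_ord // nth_ord_enum.
have sz : size [seq price i j a | a <- enum 'I_k.+2] = k.+2 by rewrite size_map size_enum_ord.
apply/(has_nthP 0)/existsP => [[x]|[a]].
  rewrite fun_if size_drop size_take_min sz => xs.
  case T : (target j) xs => xs; rewrite ?nth_drop ?nth_take; try lia.
    have xk : misses.+1 + x < k.+2 by lia.
    move=> /= pe; exists (Ordinal xk); rewrite winning_valueE T -nthE /= pe andbT; lia.
  have xk : x < k.+2 by lia.
  move=> /= pe; exists (Ordinal xk); rewrite winning_valueE T -nthE /= pe andbT; lia.
rewrite winning_valueE => /andP[wa pe]; have ak := ltn_ord a.
case T : (target j) wa => wa.
  by exists (a - misses.+1); rewrite ?size_drop ?sz ?nth_drop ?subnKC ?nthE //; lia.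
by exists a; rewrite ?size_take_min ?sz ?nth_take ?nthE //; lia.
Qed.

Lemma won_columnsE c rows es : won_columns c rows es =
  [seq size rows < 2 * count (fun we => nth 0 we.1 x <= we.2) (zip rows es) | x <- iota 0 c].
Proof.
elim: c rows => //= c IH rows; congr cons.
  by rewrite /majority /favorable count_map; congr (_ < 2 * _); apply: eq_count => -[[|? ?] ?].
rewrite IH -[1]addn0 iotaDl -map_comp; apply: eq_map => x /=.
rewrite size_map zip_behead count_map; congr (_ < 2 * _); apply: eq_count => -[ws e] /=.
by rewrite nth_behead.
Qed.

Lemma count_enum (T : finType) (P : pred T) : count P (enum T) = #|P|.
Proof. by rewrite -sum1_count big_enum_cond /= sum1_card. Qed.

Lemma won_needed_rows es : size es = m ->
  all id (won_columns n needed_rows es) =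
  [forall j, m < 2 * #|[set i | needed i j <= nth 0 es i]|].
Proof.
move=> sz; rewrite won_columnsE all_map.
have esE : es = [seq nth 0 es i | i <- enum 'I_m].
  rewrite (map_comp (nth 0 es) val) val_enum_ord -sz.
  by rewrite map_nth_iota0 // take_size.
have cE j : count (fun we => nth 0 we.1 j <= we.2) (zip needed_rows es) =
    #|[set i | needed i j <= nth 0 es i]|.
  rewrite {1}esE /needed_rows zip_map count_map -count_enum.
  apply: eq_count => i /=; rewrite -[RHS]/(i \in [set i | needed i j <= nth 0 es i]) inE.
  by rewrite (nth_map j) ?size_enum_ord // nth_ord_enum.
have sr : size needed_rows = m by rewrite size_map size_enum_ord.
apply/allP/forallP => [H j|H x].
  by have := H j; rewrite mem_iota /= sr cE => ->.
by rewrite mem_iota => /= xn; have := H (Ordinal xn); rewrite sr -cE.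
Qed.

Lemma won_strict_majorityE (q : 'I_m -> 'I_n -> rat) j :
  won_strict_majority q j = (m < 2 * #|[set i | favors q i j]|).
Proof. by rewrite /won_strict_majority ltr_pdivrMr ?ltr0n // -natrM ltr_nat mulnC. Qed.

Lemma winnable_integral : 0 < n ->
  vb_sm_winnable L <-> exists es, [/\ size es = size needed_rows, sumn es <= budget L %/ n &
    all id (won_columns n needed_rows es)].
Proof.
move=> n0; have nq0 : (0 < n%:R :> rat)%R by rewrite ltr0n.
have sr : size needed_rows = m by rewrite size_map size_enum_ord.
have sum_es (f : 'I_m -> nat) : sumn [seq f i | i <- enum 'I_m] = \sum_i f i.
  by rewrite sumnE big_map big_enum.
have nth_es (f : 'I_m -> nat) (i : 'I_m) : nth 0 [seq f i | i <- enum 'I_m] i = f i.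
  by rewrite (nth_map i) ?size_enum_ord // nth_ord_enum.
split=> [[d [[d0 dB] dw]]|[es [sz ses wes]]].
  pose e i := Num.truncn (d i / n%:R)%R.
  have en i : ((e i)%:R * n%:R <= d i)%R.
    by rewrite -ler_pdivlMr // truncn_le divr_ge0.
  (* The sum is an integer whose [n]-fold is at most the sum of the [d i], hence at most the
     budget. *)
  have eb : \sum_i e i <= budget L %/ n.
    rewrite leq_divRL // -(ler_nat rat) natrM natr_sum mulr_suml.
    by apply: le_trans dB; apply: ler_sum => i _.
  exists [seq e i | i <- enum 'I_m]; rewrite sr sum_es; split=> //.
    by rewrite size_map size_enum_ord.
  rewrite won_needed_rows; last by rewrite size_map size_enum_ord.
  apply/forallP => j.
  have := dw j; rewrite won_strict_majorityE; congr (_ < 2 * _).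
  apply: eq_card => i; rewrite !inE nth_es.
  rewrite (@favors_bribed d i j (e i)) => [|a].
    by rewrite needed_le // (leq_trans _ eb) // (bigD1 i) //= leq_addr.
  by rewrite /affordable truncn_ge_nat // divr_ge0.
rewrite sr in sz; rewrite won_needed_rows // in wes.
move/forallP: wes => wes.
exists (fun i => (nth 0 es i * n)%:R%R); split.
  split=> [i|]; first exact: ler0n.
  rewrite -natr_sum ler_nat -big_distrl /= -leq_divRL //; apply: leq_trans ses.
  rewrite -(big_mkord xpredT (nth 0 es)) -sz.
  by rewrite sumnE [leqRHS](big_nth 0).
move=> j; rewrite won_strict_majorityE; have := wes j; congr (_ < 2 * _).
apply: eq_card => i; rewrite !inE (@favors_bribed _ i j (nth 0 es i)) => [|a].
  rewrite needed_le //; apply: leq_trans ses.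
  rewrite sumnE (big_nth 0) sz (big_mkord xpredT (nth 0 es)).
  by rewrite (bigD1 i) //= leq_addr.
by rewrite /affordable natrM mulfK ?lt0r_neq0 // ler_nat.
Qed.

Lemma winnable_no_issue : n = 0 -> vb_sm_winnable L.
Proof.
move=> n0; exists (fun=> 0%R); split.
  by split=> [i|]; rewrite ?big1 // ler0n.
by move=> j; have := ltn_ord j; rewrite {2}n0.
Qed.

End Instance.

(** * A computable bound *)

Local Notation "% n" := (@Ordinal 3 n isT) (at level 0, n constr at level 0).

Definition unary3 (a b c : nat) : 'I_3 -> seq unit :=
  fun i => nth [::] [:: nseq a tt; nseq b tt; nseq c tt] i.

Definition push_tt (i : 'I_3) : cmd 2 unit := Push i (fun=> tt).

Definition power2 : cmd 2 unit :=
  Seq (push_tt %1)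
  (Seq (While (top_is predT %0)
          (Seq (Pop %0)
          (Seq (While (top_is predT %1)
                  (Seq (Pop %1) (Seq (push_tt %2) (push_tt %2))))
               (While (top_is predT %2) (Seq (Pop %2) (push_tt %1))))))
       (While (top_is predT %1) (Seq (Pop %1) (push_tt %0)))).

Lemma unary3E a b c (s : 'I_3 -> seq unit) :
  s %0 = nseq a tt -> s %1 = nseq b tt -> s %2 = nseq c tt -> s = unary3 a b c.
Proof.
move=> s0 s1 s2; apply: functional_extensionality => -[[|[|[|]]] //= lt3];
by rewrite /unary3 /= -?s0 -?s1 -?s2; congr s; apply: val_inj.
Qed.

(** Computability imposes no time bound, so the time of a run is forgotten. *)
Definition computes (c : cmd 2 unit) (s s' : 'I_3 -> seq unit) := exists T, runs c s s' T.

Lemma computes_seq c1 c2 s s1 s2 :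
  computes c1 s s1 -> computes c2 s1 s2 -> computes (Seq c1 c2) s s2.
Proof. by move=> [T1 r1] [T2 r2]; exists (T1 + T2); apply: runs_seq r2. Qed.

Lemma computes_push (i : 'I_3) a b c : computes (push_tt i) (unary3 a b c)
  (unary3 ((i == %0) + a) ((i == %1) + b) ((i == %2) + c)).
Proof.
exists 2; eapply runs_eq; first exact: runs_push.
by case: i => -[|[|[|]]] //= lt3; apply: unary3E.
Qed.

Lemma computes_pop (i : 'I_3) a b c : computes (Pop i) (unary3 a b c)
  (unary3 (a - (i == %0)) (b - (i == %1)) (c - (i == %2))).
Proof.
exists 1; eapply runs_eq; first exact: runs_pop.
case: i => -[|[|[|]]] //= lt3; rewrite ?subn0 ?subn1; apply: unary3E => //;
  rewrite /upd /unary3 /=; by [case: (a) | case: (b) | case: (c)].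
Qed.

Lemma computes_whileT (p : ('I_3 -> option unit) -> bool) c s s1 s2 : p (tops s) -> computes c s s1 ->
  computes (While p c) s1 s2 -> computes (While p c) s s2.
Proof. by move=> ps [T1 r1] [T2 r2]; eexists; apply: runs_whileT ps r1 r2. Qed.

Lemma computes_whileF (p : ('I_3 -> option unit) -> bool) c s : ~~ p (tops s) -> computes (While p c) s s.
Proof. by move=> ps; exists 1; apply: runs_whileF. Qed.

Ltac cstep := eapply computes_seq; [first [exact: computes_push | exact: computes_pop] |
  rewrite /= ?subn1 ?subn0 ?add0n ?add1n /=].

Lemma computes_power2 x : computes power2 (unary3 x 0 0) (unary3 (2 ^ x) 0 0).
Proof.
have double b a c : computes (While (top_is predT %1)
     (Seq (Pop %1) (Seq (push_tt %2) (push_tt %2)))) (unary3 a b c) (unary3 a 0 (2 * b + c)).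
  elim: b c => [|b IH] c; first exact: computes_whileF.
  eapply computes_whileT; first by [].
    by cstep; cstep; exact: computes_push.
  by have := IH c.+2; rewrite mulnS /= ?subn0 !addnS !add0n.
have back c a b : computes (While (top_is predT %2) (Seq (Pop %2) (push_tt %1)))
    (unary3 a b c) (unary3 a (c + b) 0).
  elim: c b => [|c IH] b; first exact: computes_whileF.
  eapply computes_whileT; first by [].
    by cstep; exact: computes_push.
  by have := IH b.+1; rewrite /= ?subn0 !addnS !addSn.
have down b a : computes (While (top_is predT %1) (Seq (Pop %1) (push_tt %0)))
    (unary3 a b 0) (unary3 (b + a) 0 0).
  elim: b a => [|b IH] a; first exact: computes_whileF.
  eapply computes_whileT; first by [].
    by cstep; exact: computes_push.
  by have := IH a.+1; rewrite /= ?subn0 !addnS !addSn.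
have loop y : computes (While (top_is predT %0)
    (Seq (Pop %0)
    (Seq (While (top_is predT %1) (Seq (Pop %1) (Seq (push_tt %2) (push_tt %2))))
         (While (top_is predT %2) (Seq (Pop %2) (push_tt %1))))))
    (unary3 x y 0) (unary3 0 (2 ^ x * y) 0).
  elim: x y => [|x IH] y; first by rewrite mul1n; apply: computes_whileF.
  eapply computes_whileT; first by [].
    by cstep; eapply computes_seq; [exact: double | exact: back].
  by rewrite !addn0 expnSr -mulnA; apply: IH.
rewrite /power2; cstep.
eapply computes_seq; first exact: loop.
by rewrite muln1; have := down (2 ^ x) 0; rewrite addn0.
Qed.

(** Two rounds of [power2] compute it. The offset 5 makes [2 ^ (x + 5)] dominate the exponent 11 + 4
    (x + 2) + 2 x (x + 3) of [tower_bound]; at x = 0 this exponent is 19, so 4 would be too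
    small. *)
Definition tower (x : nat) := 2 ^ 2 ^ (x + 5).

Lemma computable_tower : computable tower.
Proof.
pose c := Seq (push_tt %0) (Seq (push_tt %0) (Seq (push_tt %0) (Seq (push_tt %0)
  (Seq (push_tt %0) (Seq power2 power2))))).
exists (machine c (fun=> true)) => x.
have [T r] : computes c (input_store (nseq x tt)) (unary3 (tower x) 0 0).
  have -> : input_store (nseq x tt) = unary3 x 0 0 by apply: unary3E.
  do 5 cstep.
  eapply computes_seq; first exact: computes_power2.
  by rewrite /tower !addnS addn0; apply: computes_power2.
have [time [_ h _ o]] := machine_runs (fun=> true) r.
by exists time; split; rewrite ?h ?o.
Qed.

Lemma tower_bound B : 2001 * (B + 4) ^ 4 * 3 ^ (B * (B + 3)) <= tower B.
Proof.
have h1 : (B + 4) ^ 4 <= 2 ^ (4 * (B + 2)).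
  rewrite mulnC expnM leq_exp2r //.
  elim: B => // B IH; rewrite !addSn expnS; lia.
have h2 : 3 ^ (B * (B + 3)) <= 2 ^ (2 * (B * (B + 3))).
  by rewrite (expnM 2 2); move: (B * (B + 3)) => [|N] //; rewrite leq_exp2r.
have h3 : 11 + 4 * (B + 2) + 2 * (B * (B + 3)) <= 2 ^ (B + 5).
  elim: B {h1 h2} => // B; rewrite (addSn B 5) expnS.
  by move: (2 ^ (B + 5)) => E; nia.
apply: leq_trans (leq_mul (leq_mul (_ : 2001 <= 2 ^ 11) h1) h2) _ => //.
by rewrite -!expnD leq_pexp2l.
Qed.

Theorem theorem5p2 : fixed_parameter_tractable vb_sm_lobbying.
Proof.
(* The bound of [runs_program] is quadratic in the input length; the powers of B + 4 and the number
   of guesses are absorbed by [tower]. *)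
exists (machine program (nonempty $19)), tower, 2; split; first exact: computable_tower.
move=> L; rewrite /= in L *.
have asz : all (all (fun x : nat * nat * seq nat => size x.2 == (level L).+2)) (cells L).
  apply/allP => r /mapP[i _ ->]; apply/allP => x /mapP[j _ ->] /=.
  by rewrite size_map size_enum_ord.
have acs : all (fun cs => issues L == size cs) (cells L).
  by apply/allP => r /mapP[i _ ->]; rewrite size_map size_enum_ord.
have szs : size (targets L) = issues L by rewrite size_map size_enum_ord.
have := @runs_program (voters L) (issues L) (level L) (budget L) (threshold_num L)
  (threshold_den L) (targets L) (cells L) szs (threshold_den_gt0 L) (threshold_num_le_den L)
  acs asz.
rewrite -encode_lobbyingE -/(misses L) needed_rowsE => -[acc [s' [s19 r accE]]].
have [time [le h a _]] := machine_runs (nonempty $19) r.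
have aE : accepted (run (machine program (nonempty $19)) time (encode_lobbying L)) = (0 < acc).
  by rewrite a /= s19; case: (acc).
have won : 0 < acc <-> vb_sm_winnable L.
  rewrite accE; have [n0|n0] := posnP (issues L).
    by split=> _; [apply: winnable_no_issue | left].
  have ar : all (fun ws => size ws == issues L) (needed_rows L).
    by apply/allP => r' /mapP[i _ ->]; rewrite size_map size_enum_ord.
  have cr : all (all (leq^~ (budget L %/ issues L).+1)) (needed_rows L).
    apply/allP => r' /mapP[i _ ->]; apply/allP => w /mapP[j _ ->].
    exact: foldl_minn_le.
  rewrite winnable_integral // -exists_guess //; split=> [[n00|[_ //]]|[g [sg ag]]].
    by rewrite n00 in n0.
  right; split; last by exists g.
  (* Without voters the table is empty, and winning the first issue would require [0 < 0]. *)
  move=> c0; move: ag => /andP[_].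
  have r0 : needed_rows L = [::] by rewrite -needed_rowsE c0.
  by rewrite r0; case: (issues L) n0.
exists time; split=> //; last by rewrite -aE in won.
apply: leq_trans le _; set S := size (encode_lobbying L).
apply: leq_trans (leq_mul (tower_bound (budget L)) (leqnn (S ^ 2))).
have S0 : 0 < S.
  by rewrite /S encode_lobbyingE encode_nats_cons size_cat ltn_addr ?size_encode_nat.
rewrite expnMn -expnM (_ : 2 * 2 = 4) //.
(* Positivity lets the final step, in which the machine evaluates its answer, be absorbed by passing
   from 2000 to 2001. *)
have : 0 < S ^ 2 * (budget L + 4) ^ 4 * 3 ^ (budget L * (budget L + 3)).
  by rewrite !muln_gt0 !expn_gt0 S0 addn4.
move: (S ^ 2) ((_ + 4) ^ 4) (3 ^ _) => x y z.
rewrite (_ : 2001 * y * z * x = 2001 * (x * y * z)); last by ring.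
by rewrite (_ : 2000 * (x * y) * z = 2000 * (x * y * z)); [lia | ring].
Qed.
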